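(* Suppose that $\kappa$ is weakly compact. Then the isomorphism relation $\cong_{\mathrm{DLO}}$ on dense linear orders of size $\kappa$ is a $\Sigma^1_1$-complete equivalence relation.
   Context: $\kappa^\kappa$ carries the bounded topology (basic open sets $\{\eta\mid p\subset\eta\}$, $p\in\kappa^{<\kappa}$), $2^\kappa$ the subspace topology; Borel sets are generated from basic open sets by unions and intersections of length $\kappa$; a map between Borel subsets is Borel if preimages of open sets are Borel. An equivalence relation $E$ on a Borel $X\subseteq\kappa^\kappa$ is $\Sigma^1_1$ if it is the projection of a closed subset of $X^2\times\kappa^\kappa$; $E_1$ on $X$ is Borel-reducible to $E_2$ on $Y$ if some Borel $f\colon X\to Y$ satisfies $x_1E_1x_2\iff f(x_1)E_2f(x_2)$; an equivalence relation is $\Sigma^1_1$-complete if every $\Sigma^1_1$ equivalence relation is Borel-reducible to it. Coding: fix a bijection $\pi\colon\kappa^{<\omega}\to\kappa$; for $\eta\in2^\kappa$ and a countable relational vocabulary $\{P_n\}$, $\mathcal{A}_\eta$ has domain $\kappa$ and $(a_1,\dots,a_n)\in P_m^{\mathcal{A}_\eta}$ iff $\eta(\pi(m,a_1,\dots,a_n))=1$. With $T=\mathrm{DLO}$ the theory of dense linear orders without endpoints, $\mathrm{Mod}^\kappa_T=\{\eta\in2^\kappa\mid\mathcal{A}_\eta\models T\}$ and $\cong_T=\{(\eta,\xi)\in(2^\kappa)^2\mid(\eta,\xi\in\mathrm{Mod}^\kappa_T\wedge\mathcal{A}_\eta\cong\mathcal{A}_\xi)\text{ or }\eta,\xi\notin\mathrm{Mod}^\kappa_T\}$.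 *)

(* Defs.v *)
From HB Require Import structures.
From mathcomp Require Import all_boot all_order.
From mathcomp Require Import boolp classical_sets functions cardinality.
From mathcomp Require Import topology.

Set Implicit Arguments.
Unset Strict Implicit.
Unset Printing Implicit Defensive.

Import Order.TTheory.
Local Open Scope classical_set_scope.
Local Open Scope card_scope.
Local Open Scope order_scope.

(* A cardinal kappa is given by the linear order of its elements: a total
   order K that is well-founded and is an initial ordinal, i.e., K does not
   inject into any of its proper initial segments.  The element a : K stands
   for the ordinal {b | b < a}. *)

Definition below d (K : orderType d) (a : K) : set K := [set b | b < a].

Record is_cardinal d (K : orderType d) : Prop := IsCardinal {
  cardinal_wf : well_founded (fun a b : K => a < b);
  cardinal_initial : forall a : K, ~~ ([set: K] #<= below a)
}.

(* kappa --> (kappa)^2_2, a two-colouring of [kappa]^2 being read off c on the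
   pairs a < b. *)
Definition partition_property d (K : orderType d) : Prop :=
  forall c : K -> K -> bool,
  exists (H : set K) (i : bool), H #= [set: K] /\
    (forall a b, H a -> H b -> a < b -> c a b = i).

Record weakly_compact d (K : orderType d) : Prop := WeaklyCompact {
  wc_cardinal : is_cardinal K;
  wc_uncountable : ~~ countable [set: K];
  wc_partition : partition_property K
}.

(* The generalized Baire space kappa^kappa.  It is an alias because K -> K
   carries the product topology in the library. *)
Definition kspace d (K : orderType d) : Type := K -> K.

HB.instance Definition _ d (K : orderType d) := gen_eqMixin (kspace K).
HB.instance Definition _ d (K : orderType d) := gen_choiceMixin (kspace K).

(* The set of extensions of the restriction of p to a; every element of
   kappa^{<kappa} is such a restriction. *)
Definition basic_open d (K : orderType d) (p : kspace K) (a : K) :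
    set (kspace K) :=
  [set eta | forall b, b < a -> eta b = p b].

(* Cylinders are declared as a subbase so that no assumption on K is needed;
   as soon as K is inhabited they form a base, see open_kspaceP. *)
HB.instance Definition _ d (K : orderType d) :=
  @isSubBaseTopological.Build (kspace K) (set (kspace K))
    [set basic_open pa.1 pa.2 | pa in [set: kspace K * K]] id.

Lemma basic_open_open d (K : orderType d) (p : kspace K) (a : K) :
  open (basic_open p a).
Proof.
exists [set basic_open p a]; last by rewrite bigcup_set1.
move=> _ ->; rewrite /= /finI_from /=.
exists (finmap.fset1 (basic_open p a)); last by rewrite set_fset1 bigcap_set1.
by move=> A; rewrite finmap.in_fset1 => /eqP ->; rewrite inE; exists (p, a).
Qed.

Lemma open_kspaceP d (K : orderType d) (a0 : K) (U : set (kspace K)) :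
  open U <-> forall eta, U eta -> exists a, basic_open eta a `<=` U.
Proof.
split=> [[D' sD' <-] eta [A D'A Aeta]|h].
  have [F FD defA] := sD' _ D'A.
  suff [a ha] : exists a, basic_open eta a `<=` A.
    by exists a => xi /ha Axi; exists A.
  have bnd (B : set (kspace K)) : B \in finmap.enum_fset F ->
      exists a, basic_open eta a `<=` B.
    move=> BF; have := FD B BF; rewrite inE => -[[p a] _ /= defB].
    have : B eta by move: Aeta; rewrite -defA; apply.
    rewrite -defB => peta; exists a => xi xieta b ba.
    by rewrite xieta // peta.
  have [a ha] : exists a, forall B, B \in finmap.enum_fset F ->
      basic_open eta a `<=` B.
    elim: (finmap.enum_fset F) bnd => [|B s IH] bnd; first by exists a0.
    have [|a1 h1] := IH; first by move=> C Cs; apply: bnd; rewrite in_cons Cs orbT.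
    have [|a2 h2] := bnd B; first by rewrite in_cons eqxx.
    exists (Order.max a1 a2) => C; rewrite in_cons => /orP[/eqP ->|Cs] xi hxi.
      by apply: h2 => b ba; apply: hxi; rewrite lt_max ba orbT.
    by apply: (h1 _ Cs) => b ba; apply: hxi; rewrite lt_max ba.
  by exists a => xi hxi; rewrite -defA => B BF; apply: ha.
have -> : U = \bigcup_(pa in [set pa | basic_open pa.1 pa.2 `<=` U])
    basic_open pa.1 pa.2.
  rewrite eqEsubset; split => [eta Ueta|eta [pa /= hpa]]; last exact: hpa.
  by have [a ha] := h _ Ueta; exists (eta, a).
by apply: bigcup_open => pa _; exact: basic_open_open.
Qed.

Inductive kborel d (K : orderType d) : set (kspace K) -> Prop :=
| kborel_basic (p : kspace K) (a : K) : kborel (basic_open p a)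
| kborel_bigcup (F : K -> set (kspace K)) :
    (forall i, kborel (F i)) -> kborel (\bigcup_i F i)
| kborel_bigcap (F : K -> set (kspace K)) :
    (forall i, kborel (F i)) -> kborel (\bigcap_i F i).

(* f : X -> Y is represented by a total function, of which only the
   restriction to X matters. *)
Definition kborel_fun d (K : orderType d) (X Y : set (kspace K))
    (f : kspace K -> kspace K) : Prop :=
  set_fun X Y f /\
  (forall U : set (kspace K), open U -> kborel (X `&` f @^-1` U)).

Record borel_equivalence_space d (K : orderType d) (X : set (kspace K))
    (E : set (kspace K * kspace K)) : Prop := BorelEquivalenceSpace {
  bes_borel : kborel X;
  bes_sub : E `<=` X `*` X;
  bes_refl : forall x, X x -> E (x, x);
  bes_sym : forall x y, E (x, y) -> E (y, x);
  bes_trans : forall x y z, E (x, y) -> E (y, z) -> E (x, z)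
}.

(* The closed subsets of X^2 x kappa^kappa are the traces on it of the closed
   subsets of (kappa^kappa)^3. *)
Definition Sigma11_rel d (K : orderType d) (X : set (kspace K))
    (E : set (kspace K * kspace K)) : Prop :=
  exists2 C : set (kspace K * kspace K * kspace K),
    closed C & E = fst @` (C `&` (X `*` X `*` [set: kspace K])).

Definition borel_reducible d (K : orderType d)
    (X1 : set (kspace K)) (E1 : set (kspace K * kspace K))
    (X2 : set (kspace K)) (E2 : set (kspace K * kspace K)) : Prop :=
  exists2 f : kspace K -> kspace K, kborel_fun X1 X2 f &
    forall x y, X1 x -> X1 y -> (E1 (x, y) <-> E2 (f x, f y)).

Definition Sigma11_complete_equivalence d (K : orderType d)
    (Y : set (kspace K)) (F : set (kspace K * kspace K)) : Prop :=
  borel_equivalence_space Y F /\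
  (forall (X : set (kspace K)) (E : set (kspace K * kspace K)),
    borel_equivalence_space X E -> Sigma11_rel X E ->
    borel_reducible X E Y F).

(* a is the finite ordinal n *)
Definition is_ord d (K : orderType d) (n : nat) (a : K) : Prop :=
  below a #= `I_n.

Definition kcantor d (K : orderType d) : set (kspace K) :=
  [set eta | forall a, is_ord 0 (eta a) \/ is_ord 1 (eta a)].

(* The interpretation of P_m in A_eta; the number m is the entry j of the
   coding sequence. *)
Definition coded_rel d (K : orderType d) (pi : seq K -> K) (eta : kspace K)
    (m : nat) (s : seq K) : Prop :=
  exists2 j : K, is_ord m j & is_ord 1 (eta (pi (j :: s))).

(* The vocabulary of DLO consists of the single binary symbol P_0. *)
Definition coded_lt d (K : orderType d) (pi : seq K -> K) (eta : kspace K)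
    (a b : K) : Prop :=
  coded_rel pi eta 0 [:: a; b].

Record is_DLO (T : Type) (lt : T -> T -> Prop) : Prop := IsDLO {
  DLO_irr : forall x, ~ lt x x;
  DLO_trans : forall x y z, lt x y -> lt y z -> lt x z;
  DLO_total : forall x y, lt x y \/ x = y \/ lt y x;
  DLO_dense : forall x y, lt x y -> exists z, lt x z /\ lt z y;
  DLO_nomin : forall x, exists y, lt y x;
  DLO_nomax : forall x, exists y, lt x y
}.

Definition rel_isomorphic (T : Type) (r s : T -> T -> Prop) : Prop :=
  exists2 f : T -> T, bijective f & forall x y, r x y <-> s (f x) (f y).

Definition Mod_DLO d (K : orderType d) (pi : seq K -> K) : set (kspace K) :=
  [set eta | kcantor eta /\ is_DLO (coded_lt pi eta)].

Definition iso_DLO d (K : orderType d) (pi : seq K -> K) :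
    set (kspace K * kspace K) :=
  [set ex | (kcantor ex.1 /\ kcantor ex.2) /\
    ((Mod_DLO pi ex.1 /\ Mod_DLO pi ex.2 /\
        rel_isomorphic (coded_lt pi ex.1) (coded_lt pi ex.2)) \/
     (~ Mod_DLO pi ex.1 /\ ~ Mod_DLO pi ex.2))].

(* Main.v *)
Require Import Defs.
From mathcomp Require Import all_boot all_order all_algebra.
From mathcomp Require Import boolp classical_sets functions cardinality.
From mathcomp Require Import topology.

(* The skeleton of w : kappa -> kappa is the coloured linear order that is the
   sum, over a < kappa, of one point of colour w(a) followed by a copy of a fixed
   coloured order sigma.  The order sigma absorbs the bounded parts of such sums:
   it is isomorphic to sigma followed by the points of colours w(b), 0 < b <= e,
   and their copies of sigma.  Hence the skeletons of w and w' are isomorphic as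
   soon as w and w' agree on a closed unbounded set and at the non-limit points.
   Conversely, replace every point of colour a by a well-order of type a followed
   by a reversed one, and every point of the result by a dense order with one
   distinguishable point.  The isomorphism type of the resulting dense linear
   order determines w on a closed unbounded set.

   It remains to find w_x such that x E y iff w_x and w_y agree on a closed
   unbounded set.  Let E be the projection of a closed set D.  For limit a, let
   w_x(a) code the class of the restriction of x to a, two restrictions being
   equivalent when finite chains of approximations to D below a lead from each
   one to the other.  A witness of x E y yields such approximations on a closed
   unbounded set.  If conversely w_x and w_y agree on such a set, then, kappa
   being weakly compact, the chains found for its elements stabilize pointwise
   along some sequence of these, and they converge to a chain in E from x to y.
   Taking chains makes the approximations transitive, and costs nothing because
   E itself is transitive. *)

Set Implicit Arguments.
Unset Strict Implicit.
Unset Printing Implicit Defensive.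

Import Order.TTheory.
Local Open Scope order_scope.
Local Open Scope classical_set_scope.
Local Open Scope card_scope.

(** * Weakly compact cardinals *)

Section WellOrder.
Variables (d : Order.disp_t) (K : orderType d).
Hypothesis wf : well_founded (fun a b : K => a < b).

Lemma wo_min (S : K -> Prop) : (exists a, S a) ->
  exists2 a, S a & forall b, S b -> a <= b.
Proof.
move=> [a Sa]; elim: (wf a) Sa => {}a _ IH Sa.
have [[b [ba Sb]]|h] := pselect (exists b, b < a /\ S b); first exact: IH Sb.
exists a => // b Sb; rewrite leNgt; apply/negP => ba.
by apply: h; exists b.
Qed.

Lemma no_descent (u : nat -> K) : ~ (forall n, u n.+1 < u n).
Proof.
move=> h; have [_ [n ->] hn] : exists2 a, (exists n, a = u n) &
    forall b, (exists n, b = u n) -> a <= b.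
  by apply: wo_min; exists (u 0%N); exists 0%N.
by have := hn _ (ex_intro _ n.+1 erefl); rewrite leNgt h.
Qed.

Lemma wo_ind (P : K -> Prop) :
  (forall a, (forall b, b < a -> P b) -> P a) -> forall a, P a.
Proof. by move=> h; apply: (well_founded_ind wf). Qed.

End WellOrder.

Definition eventually_in d (K : orderType d) (Q : K -> Prop) : Prop :=
  exists xi, forall zeta, xi < zeta -> Q zeta.

Definition closed_under d (K : orderType d) (h : K -> K) (a : K) : Prop :=
  (exists b, b < a) /\ forall b, b < a -> h b < a.

Section WeaklyCompact.
Variables (d : Order.disp_t) (K : orderType d).
Hypothesis hK : weakly_compact K.
Variable pi : seq K -> K.
Hypothesis pi_inj : injective pi.

Let wf : well_founded (fun a b : K => a < b).
Proof. by case: hK => -[]. Qed.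


Lemma no_inj_below (f : K -> K) (a : K) : injective f -> ~ forall b, f b < a.
Proof.
move=> finj fa; case: hK => -[_ /(_ a) /negP h] _ _; apply: h.
have := inj_card_eq (A := [set: K]) (in2W finj).
rewrite card_eq_le => /andP[_ h]; apply: card_le_trans h _.
by apply: subset_card_le => _ [b _ <-]; exact: fa.
Qed.

(** The homogeneous set is the range of an injection that need not be increasing, so the colour is
    fixed on pairs [e a < e b]. *)
Lemma homogeneous_inj (c : K -> K -> bool) : exists (e : K -> K) (i : bool),
  injective e /\ forall a b, e a < e b -> c (e a) (e b) = i.
Proof.
case: hK => _ _ /(_ c) [H [i [HK hom]]].
move: HK; rewrite card_eq_le => /andP[_ /card_leP[f]].
exists (fun a => val (f (to_setT a))), i; split.
  move=> a b /val_inj fab.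
  have /(_ (mem_set I) (mem_set I) fab) := @inj _ _ _ f (to_setT a) (to_setT b).
  by move=> /(congr1 val).
move=> a b; apply: hom; exact: set_valP.
Qed.

(** If a were greatest, [pi [:: b]], with the value a replaced by the spare value [pi [::]], would
    inject K below a. *)
Lemma lt_succ_ex (a : K) : exists b, a < b.
Proof.
apply: contrapT => amax.
have le_a b : b <= a by rewrite leNgt; apply/negP => ab; apply: amax; exists b.
pose g b := if pi [:: b] == a then pi [::] else pi [:: b].
apply: (@no_inj_below g a) => [b b'|b]; rewrite /g.
  case: eqP => e; case: eqP => e' gg.
  - by move: (etrans e (esym e')) => /pi_inj [].
  - by move: gg => /pi_inj.
  - by move: gg => /pi_inj.
  - by move: gg => /pi_inj [].
have := le_a (pi [:: b]); have := le_a (pi [::]).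
case: eqP => [<-|/eqP ne]; rewrite !le_eqVlt; last by rewrite (negbTE ne).
by case: eqP => [/pi_inj|].
Qed.

Lemma wo_ge_inj (e : K -> K) (a : K) : injective e -> exists b, a < e b.
Proof.
move=> einj; have [a' aa'] := lt_succ_ex a; apply: contrapT => h.
apply: (no_inj_below (a := a') einj) => b; apply: le_lt_trans aa'.
by rewrite leNgt; apply/negP => ab; apply: h; exists b.
Qed.


(** Let [p u] be an index with [u < f (p u)], and colour pairs by whether [p] agrees on them. A set
    homogeneous for agreement would be bounded by a single value of [f], so [p] is injective on the
    homogeneous set. *)
Lemma cofinal_inj (J : Type) (f : J -> K) :
  (forall u, exists j, u < f j) -> exists g : K -> J, injective g.
Proof.
move=> /choice[p hp].
have [e [[] [einj hom]]] := homogeneous_inj (fun u v => `[< p u = p v >]).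
  have [b0 hb0] := wo_ge_inj (e (pi [::])) einj.
  have [b1] := wo_ge_inj (Order.max (e b0) (f (p (e b0)))) einj.
  rewrite gt_max => /andP[lt1 lt2].
  have /asboolP E := hom _ _ lt1.
  by have := lt_trans lt2 (hp (e b1)); rewrite E ltxx.
exists (p \o e) => b b' /= E; apply: contrapT => ne.
have : e b != e b' by apply/eqP => /einj.
by rewrite neq_lt => /orP[] /hom /asboolP []; rewrite E.
Qed.

Lemma regular (a : K) (f : K -> K) : exists u, forall b, b < a -> f b < u.
Proof.
apply: contrapT => h.
have fb u : exists j : {b : K | b < a}, u < f (val j).
  have [u' uu'] := lt_succ_ex u; apply: contrapT => nb; apply: h; exists u'.
  move=> b ba; apply: le_lt_trans uu'; rewrite leNgt; apply/negP => ub.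
  by apply: nb; exists (exist _ b ba).
have [g ginj] := cofinal_inj fb.
apply: (@no_inj_below (val \o g) a) => [|b]; last by rewrite /=; case: (g b).
by apply: inj_comp ginj; exact: val_inj.
Qed.

Lemma nat_bounded (f : nat -> K) : exists u, forall n, f n < u.
Proof.
apply: contrapT => h.
have fb u : exists n, u < f n.
  have [u' uu'] := lt_succ_ex u; apply: contrapT => nb; apply: h; exists u'.
  move=> n; apply: le_lt_trans uu'; rewrite leNgt; apply/negP => ub.
  by apply: nb; exists n.
have [g ginj] := cofinal_inj fb.
case: hK => _ /negP unc _; apply: unc.
by apply/countable_injP; exists g => x y _ _; exact: ginj.
Qed.

Lemma eventually_and (Q R : K -> Prop) :
  eventually_in Q -> eventually_in R -> eventually_in (fun z => Q z /\ R z).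
Proof.
move=> [x hx] [y hy]; exists (Order.max x y) => z; rewrite gt_max.
by move=> /andP[xz yz]; split; [exact: hx|exact: hy].
Qed.

Lemma eventually_imp (Q R : K -> Prop) :
  (forall z, Q z -> R z) -> eventually_in Q -> eventually_in R.
Proof. by move=> QR [x hx]; exists x => z /hx /QR. Qed.

Lemma eventually_ex (Q : K -> Prop) : eventually_in Q -> exists z, Q z.
Proof. by move=> [x hx]; have [z xz] := lt_succ_ex x; exists z; exact: hx. Qed.

Lemma eventually_gt a : eventually_in (fun z : K => a < z).
Proof. by exists a. Qed.

Lemma eventually_below (a : K) (Q : K -> K -> Prop) :
  (forall b, b < a -> eventually_in (Q b)) ->
  eventually_in (fun z => forall b, b < a -> Q b z).
Proof.
move=> h.
have /choice[f hf] b : exists x, b < a -> forall z, x < z -> Q b z.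
  have [ba|ba] := boolP (b < a); last by exists b.
  by have [x hx] := h b ba; exists x.
have [u hu] := regular a f.
by exists u => z uz b ba; apply: (hf b ba); exact: lt_trans (hu b ba) uz.
Qed.

Lemma eventually_nat (Q : nat -> K -> Prop) :
  (forall n, eventually_in (Q n)) -> eventually_in (fun z => forall n, Q n z).
Proof.
move=> /choice[f hf]; have [u hu] := nat_bounded f.
by exists u => z uz n; apply: hf; exact: lt_trans (hu n) uz.
Qed.

(* Along a homogeneous set for the lexicographic comparison of the sequences
   [i |-> S i a], every coordinate stabilizes. *)
Lemma measuring (J : Type) (code : J -> K) (S : J -> K -> bool) :
  injective code ->
  exists e : K -> K, (forall z, z <= e z) /\
    forall j, exists s, eventually_in (fun z => S j (e z) = s).
Proof.
move=> code_inj.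
pose T (i : K) (a : K) := `[< exists2 j, code j = i & S j a >].
have TS j a : T (code j) a = S j a.
  by apply/asboolP/idP => [[j' /code_inj ->]|h] //; exists j.
pose diff (i a b : K) := (forall i', i' < i -> T i' a = T i' b) /\ T i a != T i b.
have [e [o [einj hom]]] := homogeneous_inj
  (fun a b => `[< exists2 i, diff i a b & T i b >]).
have {}hom i a b : e a < e b -> diff i (e a) (e b) -> T i (e b) = o.
  move=> ab D; move: (hom _ _ ab); case: (o) => [/asboolP[i' [D1 D2] Ti']|/negbT/asboolPn nex].
    suff -> : i = i' by [].
    have [->//|ne] := eqVneq i i'; case: D => D3 D4.
    move: ne; rewrite neq_lt => /orP[lt|lt].
      by move: D4; rewrite D1 // eqxx.
    by move: D2; rewrite D3 // eqxx.
  by apply/negbTE/negP => Tb; apply: nex; exists i.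
have [r hr] : {r : K -> K & forall z, z < e (r z)}.
  apply: (@choice _ _ (fun z b => z < e b)) => z; exact: wo_ge_inj.
(* As [e] need not be monotone, stability refers to large values [e b], not to large b. *)
suff stab i : exists s, eventually_in (fun u => forall b, u = e b -> T i u = s).
  exists (e \o r); split=> [z|j]; first exact/ltW/hr.
  have [s [x hx]] := stab (code j); exists s; exists x => z xz /=.
  by rewrite -TS; apply: hx (erefl); exact: lt_trans (hr z).
elim/(wo_ind wf): i => i IH.
have [s hs] : {s : K -> bool & forall i', i' < i ->
    eventually_in (fun u => forall b, u = e b -> T i' u = s i')}.
  apply: (@choice _ _ (fun i' s => i' < i ->
    eventually_in (fun u => forall b, u = e b -> T i' u = s))) => i'.
  have [/IH[s hs]|_] := boolP (i' < i); first by exists s.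
  by exists true.
have [x hx] := eventually_below hs.
have agree a b : x < e a -> x < e b -> forall i', i' < i -> T i' (e a) = T i' (e b).
  by move=> xa xb i' i'i; rewrite (hx _ xa _ i'i a) // (hx _ xb _ i'i b).
(* Beyond x the sequences agree below i, so a change at i is a first difference and leads to the
   value [o]: once taken, [o] persists. *)
have [[b xb Tb]|nex] := pselect (exists2 b, x < e b & T i (e b) = o).
  exists o; exists (e b) => z bz c ez; subst z; rename bz into bc; apply: contrapT => /eqP ne.
  have D : diff i (e b) (e c).
    by split; [apply: agree => //; exact: lt_trans bc|rewrite Tb eq_sym].
  by move: ne; rewrite (hom _ _ _ bc D) eqxx.
exists (~~ o); exists x => z xz c ez; subst z; rename xz into xc.
case E : (T i (e c)); case: (o) nex => // nex; exfalso; apply: nex; by exists c.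
Qed.

(** * Inaccessibility *)

Lemma code_pair_inj : injective (fun p : K * K => pi [:: p.1; p.2]).
Proof. by move=> [a b] [a' b'] /pi_inj [-> ->]. Qed.

(** This is the strong limit property: by [measuring] and regularity all coordinates below v
    stabilize together, so two late indices carry the same sequence. *)
Lemma no_inj_bool (v : K) (S : K -> K -> bool) :
  ~ forall j j', (forall i, i < v -> S i j = S i j') -> j = j'.
Proof.
move=> h; have [e [ge_e st]] := measuring S (@inj_id K).
have /choice[s hs] := st.
have [x hx] := eventually_below (fun b (_ : b < v) => hs b).
have [x1 xx1] := lt_succ_ex x; have [x2 x12] := lt_succ_ex (e x1).
have e12 : e x1 = e x2.
  apply: h => i iv; rewrite hx // hx //.
  by apply: lt_trans xx1 _; exact: le_lt_trans (ge_e _) x12.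
by have := lt_le_trans x12 (ge_e x2); rewrite e12 ltxx.
Qed.

(** By recursion, [E x] is a subset of v different from all earlier ones as long as there is one. If
    some subset were never listed, [E] would contradict [no_inj_bool]. *)
Lemma bounded_sets_enum (v : K) : exists E : K -> K -> bool,
  forall S : K -> bool, exists j, forall i, i < v -> E j i = S i.
Proof.
have new (x : K) (E : forall y, y < x -> K -> bool) : exists S : K -> bool,
    (exists S' : K -> bool, forall y (yx : y < x), exists i, i < v /\ E y yx i <> S' i) ->
    forall y (yx : y < x), exists i, i < v /\ E y yx i <> S i.
  have [[S hS]|n] := pselect (exists S' : K -> bool,
    forall y (yx : y < x), exists i, i < v /\ E y yx i <> S' i); first by exists S.
  by exists xpredT.
pose F x E := projT1 (cid (new x E)).
pose E := Fix wf (fun _ => K -> bool) F.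
have EE x : E x = F x (fun y _ => E y).
  rewrite /E Fix_eq // => y f g fg; congr F.
  apply: functional_extensionality_dep => z.
  by apply: functional_extensionality_dep => zy; exact: fg.
exists E => S; apply: contrapT => nS.
apply: (@no_inj_bool v (fun i j => E j i)).
have dist x y : y < x -> exists i, i < v /\ E y i <> E x i.
  rewrite (EE x) /F; case: (cid _) => S0 /= h0; apply: h0.
  exists S => z _; apply: contrapT => nz; apply: nS; exists z => i iv.
  by apply: contrapT => ne; apply: nz; exists i.
move=> j j' jj'; apply: contrapT => /eqP.
by rewrite neq_lt => /orP[] /dist [i [iv]]; rewrite jj'.
Qed.

(* kappa^{<kappa} = kappa *)
Lemma bounded_funs_enum : exists W : K -> K -> K,
  forall (g : K -> K) (a : K), exists j, forall b, b < a -> W j b = g b.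
Proof.
have [E hE] := choice bounded_sets_enum.
have [D hD] : exists D : K -> K * K, forall p, D (pi [:: p.1; p.2]) = p.
  have /choice[D hD] u : exists p : K * K, (exists q, u = pi [:: q.1; q.2]) -> u = pi [:: p.1; p.2].
    have [[q ->]|n] := pselect (exists q : K * K, u = pi [:: q.1; q.2]).
      by exists q.
    by exists (u, u).
  exists D => p; apply/code_pair_inj/esym; exact: (hD _ (ex_intro _ p erefl)).
(* k codes a bound v and the index of a subset of v, read as the codes of the pairs in a graph; for
   a graph over a, regularity provides v. *)
pose good k b c := pi [:: b; c] < (D k).1 /\ E (D k).1 (D k).2 (pi [:: b; c]).
exists (fun k b => xget b (good k b)) => g a.
have [v hv] := regular a (fun b => pi [:: b; g b]).
have [j hj] := hE v (fun i => `[< exists b, i = pi [:: b; g b] >]).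
exists (pi [:: v; j]) => b ba.
have gE c : good (pi [:: v; j]) b c <-> c = g b.
  rewrite /good (hD (v, j)) /=; split=> [[cv]|->].
    by rewrite hj // => /asboolP[b' /pi_inj [-> ->]].
  by rewrite hv // hj ?hv //; split=> //; apply/asboolP; exists b.
by case: xgetP => [c _ /gE|/(_ (g b))] // /(_ ((gE _).2 erefl)).
Qed.

(** * Closed unbounded sets and reflection *)

Lemma closed_unbounded (h : K -> K) (a : K) :
  exists2 c, closed_under h c & a < c.
Proof.
(* [F u] exceeds u and all values of [h] up to u, so the supremum of the iterates of [F] at a is
   closed under [h]. *)
have /choice[F hF] u : exists v, u < v /\ forall b, b <= u -> h b < v.
  have [u' uu'] := lt_succ_ex u; have [v hv] := regular u' h.
  exists (Order.max u' v); split=> [|b bu]; first by rewrite lt_max uu'.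
  by rewrite lt_max hv ?orbT //; exact: le_lt_trans bu uu'.
have [c hc cmin] := wo_min wf (nat_bounded (fun n => iter n F a)).
exists c; last exact: (hc 0%N).
split=> [|b bc]; first by exists a; exact: (hc 0%N).
have [n bn] : exists n, b <= iter n F a.
  apply: contrapT => nb; have : c <= b; last by rewrite leNgt bc.
  by apply: cmin => n; rewrite ltNge; apply/negP => bn; apply: nb; exists n.
by have [_ /(_ b bn) lt] := hF (iter n F a); exact: lt_trans lt (hc n.+1).
Qed.

(** [P b] is the supremum of the closed points up to b, itself closed because suprema of closed
    points are. *)
Lemma closed_pred (h : K -> K) : exists P : K -> K, forall b c,
  closed_under h c -> c <= b -> closed_under h (P b) /\ c <= P b <= b.
Proof.
have /choice[P hP] b : exists p, forall c, closed_under h c -> c <= b ->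
    closed_under h p /\ c <= p <= b.
  have [[c0 hc0 c0b]|n] := pselect (exists2 c, closed_under h c & c <= b); last first.
    by exists b => c hc cb; exfalso; apply: n; exists c.
  have [p hp pmin] := wo_min wf (ex_intro
    (fun u => forall c, closed_under h c -> c <= b -> c <= u) b (fun _ _ cb => cb)).
  exists p => c hc cb; split; last by rewrite hp // pmin.
  split=> [|a ap].
    by have [[a ac0] _] := hc0; exists a; apply: lt_le_trans ac0 _; exact: hp.
  have [c1 [hc1 c1b ac1]] : exists c, [/\ closed_under h c, c <= b & a < c].
    apply: contrapT => na; have : p <= a; last by rewrite leNgt ap.
    apply: pmin => c1 hc1 c1b; rewrite leNgt; apply/negP => ac1.
    by apply: na; exists c1.
  by apply: lt_le_trans (hc1.2 _ ac1) _; exact: hp.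
by exists P.
Qed.

(* The functions [f p] below stand for the elements of an ultrapower that are
   reached from the identity by composing the regressive functions [g ^~ i]
   with the projection onto the closed points of h.  As the ultrapower is
   well-founded, some unbounded [f p] has only bounded successors. *)
Lemma reflection (J : Type) (code : J -> K) (h : K -> K) (g : K -> J -> K)
    (r : J -> K) : injective code ->
  (forall a i, closed_under h a -> r i < a -> g a i < a) ->
  exists A : K -> K, [/\ eventually_in (fun z => closed_under h (A z)),
    (forall a, eventually_in (fun z => a < A z)) &
    forall i, exists c, eventually_in (fun z => g (A z) i = c)].
Proof.
move=> code_inj greg; have [P hP] := closed_pred h.
pose fix f (p : seq J) (a : K) {struct p} : K := if p is i :: q then g (P (f q a)) i else a.
have pcode_inj : injective (fun q : seq J * K => pi (q.2 :: map code q.1)).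
  by move=> [p x] [q y] /pi_inj [-> /(inj_map code_inj) ->].
have [e [ge_e st]] := measuring (fun q a => f q.1 a < q.2) pcode_inj.
pose unb p := forall x, eventually_in (fun z => x <= f p (e z)).
have unbP p : unb p \/ exists x, eventually_in (fun z => f p (e z) < x).
  have [[x hx]|n] := pselect (exists x, eventually_in (fun z => f p (e z) < x)).
    by right; exists x.
  left=> x; have [[] hs] := st (p, x); first by exfalso; apply: n; exists x.
  by apply: eventually_imp hs => z /= /negbT; rewrite leNgt.
have unb0 : unb [::].
  move=> x; apply: eventually_imp (eventually_gt x) => z xz /=.
  exact: le_trans (ltW xz) (ge_e z).
have unb_pred p : unb p -> eventually_in (fun z =>
    closed_under h (P (f p (e z))) /\ P (f p (e z)) <= f p (e z)) /\
    forall a, eventually_in (fun z => a < P (f p (e z))).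
  move=> up; split=> [|a].
    have [c hc _] := closed_unbounded h (pi [::]).
    apply: eventually_imp (up c) => z cz.
    by have [? /andP[_ ?]] := hP _ _ hc cz.
  have [c hc ac] := closed_unbounded h a.
  apply: eventually_imp (up c) => z cz.
  by have [_ /andP[? _]] := hP _ _ hc cz; exact: lt_le_trans ac _.
(* Otherwise p could be prolonged forever. Countably many eventual statements hold together at some
   z, where this gives a descending sequence in K. *)
have [p [up hp]] : exists p, unb p /\ forall i, ~ unb (i :: p).
  apply: contrapT => np.
  have /choice[I hI] p : exists i, unb p -> unb (i :: p).
    have [up|nup] := pselect (unb p).
      apply: contrapT => n; apply: np; exists p; split=> // i ui.
      by apply: n; exists i.
    have [[i]|ni] := pselect (exists i : J, True); first by exists i.
    by exfalso; apply: np; exists [::]; split=> // i; exfalso; apply: ni; exists i.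
  pose q n := iter n (fun p => I p :: p) [::].
  have uq n : unb (q n) by elim: n => //= n; exact: hI.
  have [z hz] : exists z, forall n, f (q n.+1) (e z) < f (q n) (e z).
    apply: eventually_ex; apply: eventually_nat => n.
    have [h1 h2] := unb_pred _ (uq n).
    apply: eventually_imp (eventually_and h1 (h2 (r (I (q n))))) => z.
    by move=> [[hc le] lt]; apply: lt_le_trans le; exact: greg.
  exact: (no_descent wf hz).
exists (fun z => P (f p (e z))); have [h1 h2] := unb_pred _ up; split=> //.
  by apply: eventually_imp h1 => z [].
move=> i; have [/hp//|bd] := unbP (i :: p).
(* x is the least eventual strict bound, so by regularity late values are at least every y below x.
   In particular they bound each other and are equal. *)
have [x hx xmin] := wo_min wf bd.
have lo y : y < x -> eventually_in (fun z => y <= f (i :: p) (e z)).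
  move=> yx; have [[] hs] := st (i :: p, y).
    by have := xmin y hs; rewrite leNgt yx.
  by apply: eventually_imp hs => z /= /negbT; rewrite leNgt.
have hxl := eventually_and hx (eventually_below lo).
have [z0 [z0x hz0]] := eventually_ex hxl.
exists (f (i :: p) (e z0)); apply: eventually_imp hxl => z [zx hz].
by apply/eqP; rewrite eq_le [X in X && _](hz0 _ zx) (hz _ z0x).
Qed.

End WeaklyCompact.

(** * Coloured linear orders *)

Record is_slo (T : Type) (r : T -> T -> Prop) : Prop := IsSlo {
  slo_irr : forall x, ~ r x x;
  slo_trans : forall x y z, r x y -> r y z -> r x z;
  slo_total : forall x y, r x y \/ x = y \/ r y x
}.

(** On linear orders an increasing surjection is already an isomorphism. *)
Definition coloured_iso (T Q : Type) (r : T -> T -> Prop)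
    (A : set T) (ca : T -> Q) (B : set T) (cb : T -> Q) : Prop :=
  exists f : T -> T, [/\ forall a, A a -> B (f a),
    forall a a', A a -> A a' -> r a a' -> r (f a) (f a'),
    forall b, B b -> exists2 a, A a & f a = b &
    forall a, A a -> cb (f a) = ca a].

Section ColouredOrders.
Variables (T Q : Type) (r : T -> T -> Prop).
Hypothesis hr : is_slo r.

Lemma slo_asym x y : r x y -> ~ r y x.
Proof. by move=> xy yx; exact: slo_irr hr _ (slo_trans hr xy yx). Qed.

Lemma mono_reflect (A : set T) (f : T -> T) :
  (forall a a', A a -> A a' -> r a a' -> r (f a) (f a')) ->
  forall a a', A a -> A a' -> r (f a) (f a') -> r a a'.
Proof.
move=> fm a a' Aa Aa' ff; have [//|[E|lt]] := slo_total hr a a'.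
  by move: ff; rewrite E => /(slo_irr hr).
by have := slo_asym ff (fm _ _ Aa' Aa lt).
Qed.

Lemma mono_inj (A : set T) (f : T -> T) :
  (forall a a', A a -> A a' -> r a a' -> r (f a) (f a')) ->
  forall a a', A a -> A a' -> f a = f a' -> a = a'.
Proof.
move=> fm a a' Aa Aa' ff; have [lt|[//|lt]] := slo_total hr a a'.
  by have := fm _ _ Aa Aa' lt; rewrite ff => /(slo_irr hr).
by have := fm _ _ Aa' Aa lt; rewrite ff => /(slo_irr hr).
Qed.

Lemma coloured_iso_refl (A : set T) (ca cb : T -> Q) :
  (forall a, A a -> cb a = ca a) -> coloured_iso r A ca A cb.
Proof. by move=> h; exists id; split=> // b Ab; exists b. Qed.

Lemma coloured_iso_sym (A B : set T) (ca cb : T -> Q) :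
  coloured_iso r A ca B cb -> coloured_iso r B cb A ca.
Proof.
move=> [f [fB fm fs fc]].
have /choice[g hg] b : exists a, B b -> A a /\ f a = b.
  have [/fs[a Aa ab]|n] := pselect (B b); first by exists a.
  by exists b.
exists g; split=> [b /hg[]//|b b' Bb Bb' bb'|a Aa|b /hg[Ag E]].
- have [Ab Eb] := hg _ Bb; have [Ab' Eb'] := hg _ Bb'.
  by apply: (mono_reflect fm) => //; rewrite Eb Eb'.
- have [Ag E] := hg _ (fB _ Aa); exists (f a); first exact: fB.
  exact: mono_inj fm _ _ Ag Aa E.
- by rewrite -[in RHS]E fc.
Qed.

Lemma coloured_iso_trans (A B C : set T) (ca cb cc : T -> Q) :
  coloured_iso r A ca B cb -> coloured_iso r B cb C cc ->
  coloured_iso r A ca C cc.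
Proof.
move=> [f [fB fm fs fc]] [g [gC gm gs gc]]; exists (g \o f).
split=> [a /fB/gC//|a a' Aa Aa' aa'|c /gs[b /fs[a Aa <-] <-]|a Aa] /=.
- by apply: gm; [exact: fB|exact: fB|exact: fm].
- by exists a.
- by rewrite gc ?fc //; exact: fB.
Qed.

Lemma coloured_iso_union (A A' B B' : set T) (ca cb : T -> Q) :
  (forall a a', A a -> A' a' -> r a a') -> (forall b b', B b -> B' b' -> r b b') ->
  coloured_iso r A ca B cb -> coloured_iso r A' ca B' cb ->
  coloured_iso r (A `|` A') ca (B `|` B') cb.
Proof.
move=> AA' BB' [f [fB fm fs fc]] [g [gB gm gs gc]].
have dis a : A a -> A' a -> False by move=> Aa /(AA' _ _ Aa) /(slo_irr hr).
exists (fun a => if `[< A a >] then f a else g a).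
have fE a : A a -> (if `[< A a >] then f a else g a) = f a by move=> /asboolT ->.
have gE a : A' a -> (if `[< A a >] then f a else g a) = g a.
  by move=> A'a; case: asboolP => // /dis /(_ A'a).
split=> [a|a a'|b|a].
- by case=> Aa; [rewrite fE//; left; exact: fB|rewrite gE//; right; exact: gB].
- case=> Aa; case=> Aa' aa'.
  + by rewrite !fE //; exact: fm.
  + by rewrite fE // gE //; apply: BB'; [exact: fB|exact: gB].
  + by have := slo_asym aa' (AA' _ _ Aa' Aa).
  + by rewrite !gE //; exact: gm.
- by case=> [/fs[a Aa <-]|/gs[a Aa <-]]; exists a; [left|exact: fE|right|exact: gE].
- by case=> Aa; [rewrite fE// fc|rewrite gE// gc].
Qed.

Lemma coloured_iso_glue (I : Type) (ltI : I -> I -> Prop) (mu : T -> I)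
    (ca cb : T -> Q) :
  (forall a b, r a b -> mu a = mu b \/ ltI (mu a) (mu b)) ->
  (forall a b, ltI (mu a) (mu b) -> r a b) ->
  (forall i, coloured_iso r (mu @^-1` [set i]) ca (mu @^-1` [set i]) cb) ->
  coloured_iso r [set: T] ca [set: T] cb.
Proof.
move=> mu1 mu2 /choice[F hF]; exists (fun a => F (mu a) a).
have muF a : mu (F (mu a) a) = mu a by have [h _ _ _] := hF (mu a); exact: h.
split=> [//|a a' _ _ aa'|b _|a _].
- have [E|lt] := mu1 _ _ aa'; last by apply: mu2; rewrite !muF.
  by rewrite E; have [_ h _ _] := hF (mu a'); exact: h.
- have [_ _ /(_ b erefl)[a /= mua ab] _] := hF (mu b).
  by exists a => //; rewrite mua.
- by have [_ _ _ h] := hF (mu a); exact: h.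
Qed.

(** Lindenbaum's theorem: [f] maps A onto a final segment of B, and [g] maps B onto an initial
    segment of A. As for Cantor-Bernstein, close the complement of the range of [g] in A under
    [g \o f]; use [f] on the resulting set X and the inverse of [g] elsewhere. *)
Lemma coloured_iso_lindenbaum (A B : set T) (ca cb : T -> Q) (f g : T -> T) :
  (forall a, A a -> B (f a)) -> (forall b, B b -> A (g b)) ->
  (forall a a', A a -> A a' -> r a a' -> r (f a) (f a')) ->
  (forall b b', B b -> B b' -> r b b' -> r (g b) (g b')) ->
  (forall a, A a -> cb (f a) = ca a) -> (forall b, B b -> ca (g b) = cb b) ->
  (forall a b, A a -> B b -> r (f a) b -> exists2 a', A a' & f a' = b) ->
  (forall a b, A a -> B b -> r a (g b) -> exists2 b', B b' & g b' = a) ->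
  coloured_iso r A ca B cb.
Proof.
move=> fB gA fm gm fc gc ffin gini.
pose X a := exists n a0, [/\ A a0, forall b, B b -> g b <> a0 & a = iter n (g \o f) a0].
have Xstep a : X a -> X (g (f a)).
  by move=> [n [a0 [Aa0 h ->]]]; exists n.+1, a0.
have XA a : X a -> A a.
  move=> [n [a0 [Aa0 _ ->]]]; elim: n => //= n IH; exact/gA/fB.
(* X is a final segment of A, which is why the two pieces of the map fit together monotonically. *)
have Xfin a a' : X a -> A a' -> r a a' -> X a'.
  move=> [n [a0 [Aa0 ha0 ->]]] {a}; elim: n a' => [|n IH] a' Aa' lt.
    exists 0%N, a'; split=> // b Bb ba'.
    have [|b' Bb' /(ha0 _ Bb')//] := gini a0 b Aa0 Bb.
    by rewrite ba'.
  have [[b Bb ba']|nb] := pselect (exists2 b, B b & g b = a'); last first.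
    by exists 0%N, a'; split=> // b Bb ba'; apply: nb; exists b.
  have Xn : X (iter n (g \o f) a0) by exists n, a0.
  have An := XA _ Xn; move: lt; rewrite -ba' /= => /(mono_reflect gm (fB _ An) Bb) lt.
  have [a2 Aa2 E] := ffin _ _ An Bb lt; rewrite -E; apply: Xstep.
  by apply: IH => //; apply: (mono_reflect fm) => //; rewrite E.
have /choice[h hh] a : exists b, A a -> [/\ B b, X a -> b = f a & ~ X a -> g b = a].
  have [Aa|?] := pselect (A a); last by exists a.
  have [Xa|nXa] := pselect (X a); first by exists (f a); split=> //; exact: fB.
  have [[b Bb ba]|nb] := pselect (exists2 b, B b & g b = a); first by exists b.
  exfalso; apply: (nXa); exists 0%N, a; split=> // b Bb ba; apply: nb; by exists b.
exists h; split=> [a /hh[]//|a a' Aa Aa' aa'|b Bb|a Aa].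
- have [Ba hX hn] := hh _ Aa; have [Ba' hX' hn'] := hh _ Aa'.
  have [Xa|nXa] := pselect (X a).
    by rewrite hX // hX'; [exact: fm|exact: Xfin Xa Aa' aa'].
  have [Xa'|nXa'] := pselect (X a'); last first.
    by apply: (mono_reflect gm) => //; rewrite hn // hn'.
  rewrite [h a']hX'//; have [//|[E|lt]] := slo_total hr (h a) (f a').
    by exfalso; apply: (nXa); rewrite -(hn nXa) E; exact: Xstep.
  exfalso; apply: (nXa); have [a2 Aa2 E] := ffin _ _ Aa' Ba lt.
  rewrite -(hn nXa) -E; apply/Xstep/(Xfin a') => //.
  by apply: (mono_reflect fm) => //; rewrite E.
- have [[[|n] [a0 [Aa0 h0 E]]]|nX] := pselect (X (g b)).
  + by have := h0 _ Bb E.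
  + have Xn : X (iter n (g \o f) a0) by exists n, a0.
    have An := XA _ Xn; have [_ hX _] := hh _ An.
    exists (iter n (g \o f) a0) => //; rewrite hX //.
    by apply: (mono_inj gm) => //; exact: fB.
  + exists (g b); first exact: gA.
    have [Bh _ hn] := hh _ (gA _ Bb).
    by apply: (mono_inj gm) => //; exact: hn.
- have [Ba hX hn] := hh _ Aa.
  have [Xa|nXa] := pselect (X a); first by rewrite hX // fc.
  by rewrite -[in RHS](hn nXa) gc.
Qed.

End ColouredOrders.

(** * Skeletons *)

Definition lex_sum (A B : Type) (r : A -> A -> Prop) (s : A -> B -> B -> Prop)
    (p q : A * B) : Prop :=
  r p.1 q.1 \/ p.1 = q.1 /\ s p.1 p.2 q.2.

Fixpoint lex_seq (T : Type) (r : T -> T -> Prop) (s t : seq T) : Prop :=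
  match s, t with
  | a :: s', b :: t' => r a b \/ a = b /\ lex_seq r s' t'
  | [::], _ :: _ => True
  | _, [::] => False
  end.

(* Unlike in [lex_seq], a proper extension is smaller. *)
Fixpoint colex_seq (T : Type) (r : T -> T -> Prop) (s t : seq T) : Prop :=
  match s, t with
  | a :: s', b :: t' => r a b \/ a = b /\ colex_seq r s' t'
  | _ :: _, [::] => True
  | [::], _ => False
  end.

Lemma slo_lt d (K : orderType d) : is_slo (fun a b : K => a < b).
Proof.
split=> [x|x y z|x y]; [by rewrite ltxx|exact: lt_trans|].
by case: (ltgtP x y) => ?; [left|right; right|right; left].
Qed.

Lemma slo_lex_sum (A B : Type) (r : A -> A -> Prop) (s : A -> B -> B -> Prop) :
  is_slo r -> (forall a, is_slo (s a)) -> is_slo (lex_sum r s).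
Proof.
move=> hr hs; split=> [[a b]|[a b] [a' b'] [a'' b'']|[a b] [a' b']]; rewrite /lex_sum /=.
- by case=> [h|[_ h]]; [exact: (slo_irr hr h)|exact: (slo_irr (hs a) h)].
- case=> [aa'|[-> bb']]; case=> [aa''|[<- b'b'']].
  + by left; exact: (slo_trans hr aa' aa'').
  + by left.
  + by left.
  + by right; split=> //; exact: (slo_trans (hs a') bb' b'b'').
- have [?|[<-|?]] := slo_total hr a a'; [by left; left| |by right; right; left].
  have [?|[<-|?]] := slo_total (hs a) b b'; [by left; right| |by right; right; right].
  by right; left.
Qed.

Lemma slo_inj (A B : Type) (f : A -> B) (r : B -> B -> Prop) :
  injective f -> is_slo r -> is_slo (fun a a' => r (f a) (f a')).
Proof.
move=> finj hr; split=> [x|x y z|x y]; [exact: (slo_irr hr)|exact: (slo_trans hr)|].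
by have [?|[/finj ?|?]] := slo_total hr (f x) (f y); [left|right; left|right; right].
Qed.

Section SloSeq.
Variables (T : Type) (r : T -> T -> Prop).
Hypothesis hr : is_slo r.

Lemma slo_lex_seq : is_slo (lex_seq r).
Proof.
split=> [|x y z|].
- by elim=> //= a s IH [h|[_ /IH]]; first exact: (slo_irr hr h).
- elim: x y z => [|a x IH] [|b y] [|c z] //= [ab|[-> xy]] [bc|[<- yz]].
  + by left; exact: (slo_trans hr ab bc).
  + by left.
  + by left.
  + by right; split=> //; exact: (IH _ _ xy yz).
- elim=> [|a x IH] [|b y] /=; try by [right; left|left|right; right].
  have [?|[<-|?]] := slo_total hr a b; [by left; left| |by right; right; left].
  by have [?|[<-|?]] := IH y; [left; right|right; left|right; right; right].
Qed.

Lemma slo_colex_seq : is_slo (colex_seq r).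
Proof.
split=> [|x y z|].
- by elim=> //= a s IH [h|[_ /IH]]; first exact: (slo_irr hr h).
- elim: x y z => [|a x IH] [|b y] [|c z] //= [ab|[-> xy]] [bc|[<- yz]].
  + by left; exact: (slo_trans hr ab bc).
  + by left.
  + by left.
  + by right; split=> //; exact: (IH _ _ xy yz).
- elim=> [|a x IH] [|b y] /=; try by [right; left|left|right; right].
  have [?|[<-|?]] := slo_total hr a b; [by left; left| |by right; right; left].
  by have [?|[<-|?]] := IH y; [left; right|right; left|right; right; right].
Qed.

End SloSeq.

Definition is_limit d (K : orderType d) (a : K) : Prop :=
  (exists b, b < a) /\ forall b, b < a -> exists2 b', b < b' & b' < a.

Section Skeleton.
Variables (d : Order.disp_t) (K : orderType d).
Hypothesis wf : well_founded (fun a b : K => a < b).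
Variable o : K.
Hypothesis o_le : forall a : K, o <= a.
Variable W : K -> K -> K.
Hypothesis W_enum : forall (g : K -> K) (a : K), exists j, forall b, b < a -> W j b = g b.
Hypothesis lt_succ : forall a : K, exists b, a < b.

(* The order of K with its least element moved to the end: a tile represents a
   word at its positions b > o only, so these have to be an initial segment. *)
Definition tile_lt (b b' : K) : Prop := b <> o /\ (b' = o \/ b < b').

(* A position (i, b) is the entry b of the word coded by the last entry of i.
   The point of the nondecreasing sequences is that those below [:: j] are
   isomorphic to all of them, see [push]. *)
Definition position : Type := {p : seq K * K | (p.1 != [::]) && sorted <=%O p.1}.

Definition position_lt (p q : position) : Prop :=
  lex_sum (colex_seq (fun a b : K => a < b)) (fun _ => tile_lt) (val p) (val q).

Definition position_colour (p : position) : K := W (last o (val p).1) (val p).2.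

(** [(a, [::])] is the point of colour w(a), and the nonempty sequences form sigma. As prefixes come
    first, sigma is the sum over all positions of a point followed by a copy of sigma. *)
Definition skeleton : Type := K * seq position.

Definition skeleton_lt : skeleton -> skeleton -> Prop :=
  lex_sum (fun a b : K => a < b) (fun _ => lex_seq position_lt).

Definition skeleton_colour (w : K -> K) (n : skeleton) : K :=
  if n.2 is p :: s then position_colour (last p s) else w n.1.

Lemma slo_tile : is_slo tile_lt.
Proof.
split=> [x|x y z|x y]; rewrite /tile_lt.
- by case=> xo []//; rewrite ltxx.
- case=> xo [->|xy] [yo [->|yz]] //; split=> //; try by left.
  by right; exact: (lt_trans xy yz).
- have [->|/eqP xo] := eqVneq x o; have [->|/eqP yo] := eqVneq y o.
  + by right; left.
  + by right; right; split=> //; left.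
  + by left; split=> //; left.
  + have [xy|[xy|xy]] := slo_total (slo_lt K) x y; [left|right; left|right; right] => //.
      by split=> //; right.
    by split=> //; right.
Qed.

Lemma slo_position : is_slo position_lt.
Proof.
apply: slo_inj; first exact: val_inj.
by apply: slo_lex_sum => [|_]; [apply/slo_colex_seq/slo_lt|exact: slo_tile].
Qed.

Lemma slo_skeleton : is_slo skeleton_lt.
Proof.
by apply: slo_lex_sum => [|_]; [exact: slo_lt|exact/slo_lex_seq/slo_position].
Qed.

(* [bush a] is the copy of sigma that follows the point (a, [::]). *)
Definition bush (a : K) : set skeleton := [set n | n.1 = a /\ n.2 <> [::]].
Definition segment (a e : K) : set skeleton := [set n | a < n.1 /\ n.1 <= e].

(** An isomorphism from the nonempty nondecreasing sequences onto those below [[:: j]], which start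
    below j or with j and a further entry. It keeps the last entry, hence the colour. *)
Definition push (j : K) (i : seq K) : seq K :=
  if i is k :: _ then if j <= k then j :: i else i else i.

Lemma push_proof (j : K) (p : position) :
  (push j (val p).1 != [::]) && sorted <=%O (push j (val p).1).
Proof.
by case: p => -[[|k i] b] //= h; case: ifP => // jk; rewrite /= jk.
Qed.

Definition push_position (j : K) (p : position) : position :=
  exist _ (push j (val p).1, (val p).2) (push_proof j p).

Definition tile_position (j b : K) : position := exist _ ([:: j], b) isT.

Lemma push_position_colour j p : position_colour (push_position j p) = position_colour p.
Proof.
case: p => -[[|k i] b] //= h; rewrite /position_colour /=.
by case: ifP.
Qed.

Lemma push_position_mono j p q :
  position_lt p q -> position_lt (push_position j p) (push_position j q).
Proof.
case: p => -[[|k i] b] //= hp; case: q => -[[|k' i'] b'] //= hq.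
rewrite /position_lt /lex_sum /=; case: (leP j k) => jk; case: (leP j k') => jk' /=.
- case=> [[kk'|[-> ii']]|[[-> ->]] bb'].
  + by left; right; split=> //; left.
  + by left; right; split=> //; right.
  + by right.
- have kk' : k' < k by exact: lt_le_trans jk.
  case=> [[kk''|[E _]]|[[E _]] _].
  + by have := lt_trans kk' kk''; rewrite ltxx.
  + by rewrite E ltxx in kk'.
  + by rewrite E ltxx in kk'.
- by move=> _; left; left.
- by [].
Qed.

Lemma push_position_lt_tile j p b : position_lt (push_position j p) (tile_position j b).
Proof.
case: p => -[[|k i] c] //= hp; rewrite /position_lt /lex_sum /=; left.
by case: (leP j k) => jk /=; [right|left].
Qed.

Lemma lt_tile_position j p b : position_lt p (tile_position j b) ->
  (exists q, push_position j q = p) \/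
  (exists b', p = tile_position j b' /\ tile_lt b' b).
Proof.
case: p => -[[|k i] c] //= hp; rewrite /position_lt /lex_sum /=.
case=> [[kj|[E ne]]|[[E1 E2] cb]].
- left; exists (exist _ (k :: i, c) hp); apply: val_inj => /=.
  by rewrite leNgt kj.
- case: i hp ne => [//|k' i] hp _; left.
  have /andP[kk' hp'] : (k <= k') && path <=%O k' i := hp.
  have hq : ((k' :: i, c).1 != [::]) && sorted <=%O (k' :: i, c).1 by [].
  exists (exist _ (k' :: i, c) hq); apply: val_inj => /=.
  by rewrite -E kk'.
- by right; exists c; split=> //; apply: val_inj; rewrite /= E1 E2.
Qed.

(* The left-hand side is a final segment of the right-hand side, which
   conversely is an initial segment of it through [push_position j] and
   [tile_position j], where j is a word that agrees with w up to e. *)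
Lemma bush_absorbs_initial (w : K -> K) (e : K) :
  coloured_iso skeleton_lt (bush o) (skeleton_colour w)
    (bush o `|` segment o e) (skeleton_colour w).
Proof.
(* [W_enum] reaches only strictly below its bound, which is therefore taken above e. *)
have [e' ee'] := lt_succ e; have [j hj] := W_enum w e'.
pose f (n : skeleton) : skeleton := (e, n.2).
(* [bush o] goes to the part below the tiles of j, and level b > o becomes the tile b of j with its
   copy of sigma. *)
pose g (n : skeleton) : skeleton := (o, if n.1 == o then
  if n.2 is p :: s then push_position j p :: s else [::]
  else tile_position j n.1 :: n.2).
have oe (n : skeleton) : (bush o `|` segment o e) n -> n.1 <= e.
  by case=> [[-> _]|[_]].
apply: (coloured_iso_lindenbaum slo_skeleton (f := f) (g := g)).
- move=> [a s] [/= -> ns]; rewrite /f /=; have := o_le e; rewrite le_eqVlt => /orP[/eqP <-|oe'].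
    by left.
  by right.
- move=> [a s]; rewrite /g => -[[/= -> ns]|[/= oa ae]]; rewrite ?eqxx ?(gt_eqF oa); split=> //=.
  by case: s ns.
- move=> [a s] [a' s'] [/= -> ns] [/= -> ns']; rewrite /skeleton_lt /lex_sum /= ltxx.
  by case=> // -[_ ss']; right.
- move=> [a [|p s]] [a' s'].
    move=> [[/= _ //]|[/= oa ae]] [[/= -> ns']|[/= oa' ae']].
      rewrite /skeleton_lt /lex_sum /= => -[lt|[E]].
        by have := lt_trans lt oa; rewrite ltxx.
      by rewrite E ltxx in oa.
    rewrite /skeleton_lt /lex_sum /g /= !gt_eqF //= ltxx => -[lt|[-> ss']]; right; split=> //.
      left; rewrite /position_lt /lex_sum /=; right; split=> //.
      by split; [move=> E; rewrite E ltxx in oa|right].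
    by right.
  move=> [[/= -> _]|[/= oa ae]] [[/= -> ns']|[/= oa' ae']].
  + rewrite /skeleton_lt /lex_sum /g /= eqxx ltxx; case: s' ns' => // p' s' _.
    case=> // -[_ [pp'|[-> ss']]]; right; split=> //; last by right.
    by left; exact: push_position_mono.
  + move=> _; right; rewrite /g /= eqxx gt_eqF //; split=> //; left.
    exact: push_position_lt_tile.
  + rewrite /skeleton_lt /lex_sum /= => -[lt|[E]].
      by have := lt_trans lt oa; rewrite ltxx.
    by rewrite E ltxx in oa.
  + rewrite /skeleton_lt /lex_sum /g /= !gt_eqF //= ltxx => -[lt|[-> ss']]; right; split=> //.
      left; rewrite /position_lt /lex_sum /=; right; split=> //.
      by split; [move=> E; rewrite E ltxx in oa|right].
    by right.
- by move=> [a [|p s]] [].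
- move=> [a s] [[/= -> ns]|[/= oa ae]]; rewrite /g /skeleton_colour /=.
    rewrite eqxx; case: s ns => // p [|q s] _ //=; exact: push_position_colour.
  rewrite gt_eqF //; case: s => //=; rewrite /position_colour /= hj //.
  exact: (le_lt_trans ae ee').
- move=> [a s] [b t] [/= -> ns] /oe /= be; rewrite /skeleton_lt /lex_sum /=.
  rewrite ltNge be /= => -[//|[<- st]]; exists (o, t) => //; split=> //=.
  by move: st; case: t => //; case: s ns.
- move=> [a [|p s]] [b t] [/= -> // _] Bb.
  rewrite /skeleton_lt /lex_sum /= ltxx => -[//|[_]].
  have push_case q : push_position j q = p ->
      exists2 b', (bush o `|` segment o e) b' & g b' = (o, p :: s).
    by move=> qp; exists (o, q :: s); [left|rewrite /g /= eqxx qp].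
  have tile_case c : p = tile_position j c -> o < c -> c <= e ->
      exists2 b', (bush o `|` segment o e) b' & g b' = (o, p :: s).
    by move=> pc oc ce; exists (c, s); [right|rewrite /g /= gt_eqF // pc].
  case: Bb => [[/= -> ]|[/= ob be]].
    case: t => // p' t _; rewrite eqxx => -[pp'|[pE _]]; last exact: (push_case p' (esym pE)).
    have pt := slo_trans slo_position pp' (push_position_lt_tile j p' o).
    have [[q]|[b' [pb' _]]] := lt_tile_position pt; first exact: push_case.
    have := push_position_lt_tile j p' b'; rewrite -pb' => /(slo_asym slo_position).
    by move=> /(_ pp').
  rewrite gt_eqF // => -[pb|[pE _]]; last exact: (tile_case b pE).
  have [[q]|[b' [pb' [b'o [bo|b'b]]]]] := lt_tile_position pb; first exact: push_case.
    by rewrite bo ltxx in ob.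
  apply: (tile_case b') => //; last exact: (le_trans (ltW b'b) be).
  by rewrite lt_neqAle o_le andbT eq_sym; apply/eqP.
Qed.

Lemma bush_move (a b : K) (w w' : K -> K) :
  coloured_iso skeleton_lt (bush a) (skeleton_colour w) (bush b) (skeleton_colour w').
Proof.
exists (fun n => (b, n.2)); split=> [[c s] []//|[c s] [c' s']|[c s] [/= -> ns]|[c [|p s]] []//].
  move=> [/= -> ns] [/= -> ns']; rewrite /skeleton_lt /lex_sum /= ltxx.
  by case=> // -[_ h]; right.
by exists (a, s).
Qed.

(** Split the segment from o to c at phi: its lower part with [bush o] is isomorphic to [bush o],
    hence to [bush phi]. *)
Lemma bush_absorbs (phi c : K) (w : K -> K) : phi <= c ->
  coloured_iso skeleton_lt (bush phi `|` segment phi c) (skeleton_colour w)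
    (bush o) (skeleton_colour w).
Proof.
move=> pc; have slo := slo_skeleton.
apply: coloured_iso_trans (coloured_iso_sym slo (bush_absorbs_initial w c)).
have -> : bush o `|` segment o c = (bush o `|` segment o phi) `|` segment phi c.
  rewrite -setUA; congr (_ `|` _); apply/seteqP; split=> [n [/= on nc]|n].
    by have [np|pn] := leP n.1 phi; [left|right].
  by case=> -[/= h1 h2]; split=> //; [exact: le_trans pc|exact: le_lt_trans (o_le _) h1].
apply: (coloured_iso_union slo).
- by move=> [a s] [a' s'] [/= -> _] [/= lt _]; left.
- move=> [a s] [a' s'] + [/= lt _]; case=> -[/= h1 h2]; left => /=.
    by rewrite h1; exact: (le_lt_trans (o_le _) lt).
  exact: (le_lt_trans h2 lt).
- apply: coloured_iso_trans (bush_absorbs_initial w phi).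
  exact: bush_move.
- exact: coloured_iso_refl.
Qed.

(** Cut the skeleton into blocks of levels with the same next closed point. All of a block after its
    first point is isomorphic to sigma, so only the colour of the first point matters. *)
Lemma coloured_iso_agree (h wx wy : K -> K) :
  (forall a, exists2 c, closed_under h c & a < c) ->
  (forall c, closed_under h c -> wx c = wy c) ->
  (forall a, ~ is_limit a -> wx a = wy a) ->
  coloured_iso skeleton_lt [set: skeleton] (skeleton_colour wx)
    [set: skeleton] (skeleton_colour wy).
Proof.
move=> unb eq_closed eq_nonlim; have slo := slo_skeleton.
have /choice[m hm] a : exists c, [/\ closed_under h c, a <= c &
    forall c', closed_under h c' -> a <= c' -> c <= c'].
  have [c hc ac] := unb a.
  have [c' [hc' ac'] min] := wo_min wf (ex_intro
    (fun c => closed_under h c /\ a <= c) c (conj hc (ltW ac))).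
  by exists c'; split=> // b hb ab; exact: min.
have m_closed a : closed_under h (m a) by have [] := hm a.
have le_m a : a <= m a by have [] := hm a.
have m_min a c : closed_under h c -> a <= c -> m a <= c by have [_ _] := hm a; apply.
have m_mono a b : a <= b -> m a <= m b by move=> ab; apply: m_min => //; exact: le_trans ab _.
apply: (coloured_iso_glue (ltI := fun a b => a < b) (mu := fun n : skeleton => m n.1)).
- move=> [a s] [a' s'] /= aa'; have /m_mono : a <= a' by case: aa' => /= [/ltW|[->]].
  by rewrite le_eqVlt => /orP[/eqP|]; [left|right].
- move=> [a s] [a' s'] /= lt; left => /=; rewrite ltNge; apply/negP => /m_mono.
  by rewrite leNgt lt.
move=> c; have [ex|nex] := pselect (exists a, m a = c); last first.
  by apply: coloured_iso_refl => n /= mn; exfalso; apply: nex; exists n.1.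
have [phi mphi phi_min] := wo_min wf ex.
have c_closed : closed_under h c by rewrite -mphi.
have phi_c : phi <= c by rewrite -mphi.
have -> : (fun n : skeleton => m n.1) @^-1` [set c] =
    [set (phi, [::])] `|` (bush phi `|` segment phi c).
  apply/seteqP; split=> [[a s] /= mac|[a s] /=].
    have := phi_min a mac; rewrite le_eqVlt => /orP[/eqP pa|pa]; last first.
      by right; right; split=> //=; rewrite -mac.
    by rewrite -pa; case: s => [|p s]; [left|right; left].
  case=> [[-> _]|[[/= -> _]|[/= pa ac]]] //.
  by apply/eqP; rewrite eq_le m_min //= -mphi m_mono // ltW.
(* The first level phi of a block is closed or not a limit: the closed points [m b'] with [b' < phi]
   lie below phi, so a limit phi is a limit of closed points. *)
have same : wx phi = wy phi.
  have [hphi|nhphi] := pselect (closed_under h phi); first exact: eq_closed.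
  apply: eq_nonlim => lim; apply: nhphi; split=> [|b bp]; first by case: lim.
  have m_lt b' : b' < phi -> m b' < phi.
    move=> bp'; rewrite ltNge; apply/negP => pm.
    have : phi <= b'; last by rewrite leNgt bp'.
    apply: phi_min; apply/eqP; rewrite eq_le m_min //=; last exact: (le_trans (ltW bp') phi_c).
    by rewrite -mphi m_min.
  have [b' bb' bp'] := lim.2 b bp.
  apply: lt_trans (m_lt _ bp'); apply: (m_closed b').2.
  exact: (lt_le_trans bb' (le_m _)).
have below w n n' : [set (phi, [::])] n -> (bush phi `|` segment phi c) n' -> skeleton_lt n n'.
  move=> /= ->; case: n' => a s [[/= -> ns]|[/= pa _]]; last by left.
  by right; split=> //=; case: s ns.
apply: (coloured_iso_union slo); [exact: below wx|exact: below wx| |].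
  by apply: coloured_iso_refl => n ->.
apply: coloured_iso_trans (bush_absorbs wx phi_c) _.
apply: coloured_iso_trans (bush_move o o wx wy) _.
exact: (coloured_iso_sym slo (bush_absorbs wy phi_c)).
Qed.

End Skeleton.

(** * Dense orders from skeletons *)

Lemma inj_surj_bijective (T U : Type) (f : T -> U) :
  injective f -> (forall u, exists t, f t = u) -> bijective f.
Proof.
move=> finj /choice[g hg]; exists g => // t; apply: finj; exact: hg.
Qed.

Lemma bernstein (T U : Type) (f : T -> U) (g : U -> T) :
  injective f -> injective g -> exists h : T -> U, bijective h.
Proof.
move=> finj ginj.
have le (A B : Type) (k : A -> B) : injective k -> [set: A] #<= [set: B].
  move=> kinj; have := inj_card_eq (A := [set: A]) (in2W kinj).
  rewrite card_eq_le => /andP[_ h]; apply: card_le_trans h _.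
  exact: subset_card_le.
have /card_eqP[h] := Cantor_Bernstein (le _ _ _ finj) (le _ _ _ ginj).
exists (fun a => val (h (to_setT a))); apply: inj_surj_bijective => [a b /val_inj E|u].
  have /(_ (mem_set I) (mem_set I) E) := @inj _ _ _ h (to_setT a) (to_setT b).
  by move=> /(congr1 val).
have /(_ (to_setT u) I)[t _ E] : set_surj [set: _] [set: _] h by exact: surj.
exists (val t); rewrite -[RHS]/(val (to_setT u)) -E; congr (val (h _)).
exact: val_inj.
Qed.

Definition sum_lt (A B : Type) (r : A -> A -> Prop) (s : B -> B -> Prop) (x y : A + B) : Prop :=
  match x, y with
  | inl a, inl a' => r a a'
  | inl _, inr _ => True
  | inr _, inl _ => False
  | inr b, inr b' => s b b'
  end.

Lemma slo_sum (A B : Type) (r : A -> A -> Prop) (s : B -> B -> Prop) :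
  is_slo r -> is_slo s -> is_slo (sum_lt r s).
Proof.
move=> hr hs; split=> [[a|b]|[a|b] [a'|b'] [a''|b'']|[a|b] [a'|b']] //=.
- exact: (slo_irr hr).
- exact: (slo_irr hs).
- exact: (slo_trans hr).
- exact: (slo_trans hs).
- by have [?|[->|?]] := slo_total hr a a'; [left|right; left|right; right].
- by left.
- by right; right.
- by have [?|[->|?]] := slo_total hs b b'; [left|right; left|right; right].
Qed.

Section Filling.
Variables (d : Order.disp_t) (K : orderType d).
Hypothesis wf : well_founded (fun a b : K => a < b).
Variable o : K.
Hypothesis o_le : forall a : K, o <= a.
Variable W : K -> K -> K.
Hypothesis lt_succ : forall a : K, exists b, a < b.
Hypothesis nat_bounded : forall f : nat -> K, exists u, forall n, f n < u.

(* The elements below a in increasing order, followed by the others in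
   decreasing order: a is the type of the largest well-ordered initial segment. *)
Definition stem_lt (a b b' : K) : Prop := if b < a then b < b' else (a <= b') && (b' < b).

Lemma slo_stem (a : K) : is_slo (stem_lt a).
Proof.
split=> [x|x y z|x y]; rewrite /stem_lt.
- by rewrite !ltxx andbF; case: ifP.
- case: (ltP x a) => xa; case: (ltP y a) => ya.
  + exact: lt_trans.
  + by move=> _ /andP[az _]; exact: lt_le_trans az.
  + by [].
  + by move=> /andP[_ yx] /andP[-> zy]; exact: lt_trans yx.
- case: (ltP x a) => xa; case: (ltP y a) => ya.
  + exact: (slo_total (slo_lt K)).
  + by left; exact: lt_le_trans ya.
  + by right; right; exact: lt_le_trans xa.
  + by have [?|[->|?]] := slo_total (slo_lt K) x y; [right; right|right; left|left].
Qed.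

Definition stem : Type := skeleton K * K.

Definition stems_lt (w : K -> K) : stem -> stem -> Prop :=
  lex_sum (skeleton_lt o) (fun n => stem_lt (skeleton_colour o W w n)).

Lemma slo_stems w : is_slo (stems_lt w).
Proof. by apply: slo_lex_sum => [|a]; [exact: slo_skeleton|exact: slo_stem]. Qed.

(** A copy of the rationals, one point, and copies of the rationals along K reversed. The reversed K
    keeps countable sequences from converging to the marker from above. *)
Definition filling : Type := rat + (unit + K * rat).

Definition filling_lt : filling -> filling -> Prop :=
  sum_lt (fun q r : rat => q < r)
    (sum_lt (fun _ _ => False)
      (lex_sum (fun a b : K => b < a) (fun _ (q r : rat) => q < r))).

Definition marker : filling := inr (inl tt).

Lemma slo_filling : is_slo filling_lt.
Proof.
apply: slo_sum; first exact: slo_lt.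
apply: slo_sum; first by split=> // -[] []; right; left.
apply: slo_lex_sum => [|_]; last exact: slo_lt.
split=> [x|x y z|x y]; first by rewrite ltxx.
  by move=> h1 h2; exact: lt_trans h1.
by have [?|[->|?]] := slo_total (slo_lt K) x y; [right; right|right; left|left].
Qed.

Definition filled : Type := stem * filling.

Definition filled_lt (w : K -> K) : filled -> filled -> Prop :=
  lex_sum (stems_lt w) (fun _ => filling_lt).

Lemma slo_filled w : is_slo (filled_lt w).
Proof. by apply: slo_lex_sum => [|a]; [exact: slo_stems|exact: slo_filling]. Qed.

Lemma lt_rat1 (q : rat) : q < (q + 1)%R.
Proof. by rewrite Num.Theory.ltrDl. Qed.

Lemma gt_rat1 (q : rat) : (q - 1)%R < q.
Proof. by rewrite Num.Theory.gtrBl. Qed.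

Lemma filling_gt v : exists v', filling_lt v v'.
Proof.
case: v => [q|[[]|[k q]]]; first by exists marker.
  by exists (inr (inr (o, 0%R))).
by exists (inr (inr (k, q + 1)%R)); right; split=> //; exact: lt_rat1.
Qed.

Lemma filled_DLO w : is_DLO (filled_lt w).
Proof.
have slo := slo_filled w; split.
- exact: (slo_irr slo).
- by move=> x y z; exact: (slo_trans slo).
- exact: (slo_total slo).
- move=> [l v] [l' v'] [/= lt|[/= <- vv']].
    by have [v2 h] := filling_gt v; exists (l, v2); split; [right|left].
  suff [v2 [h1 h2]] : exists v2, filling_lt v v2 /\ filling_lt v2 v'.
    by exists (l, v2); split; right.
  case: v v' vv' => [q|[[]|[k q]]] [q'|[[]|[k' q']]] //= lt.
  + by exists (inl ((q + q') / 2)%R) => /=; rewrite !Num.Theory.midf_lt.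
  + by exists (inl (q + 1)%R) => /=; split=> //; exact: lt_rat1.
  + by exists (inl (q + 1)%R) => /=; split=> //; exact: lt_rat1.
  + by exists (inr (inr (k', q' - 1)%R)); split=> //; right; split=> //; exact: gt_rat1.
  + case: lt => /= [kk'|[<- qq']].
      by exists (inr (inr (k, q + 1)%R)); split; [right; split=> //; exact: lt_rat1|left].
    exists (inr (inr (k, (q + q') / 2)%R)); split; right; split=> //=;
    by rewrite Num.Theory.midf_lt.
- move=> [l [q|v]]; first by exists (l, inl (q - 1)%R); right; split=> //; exact: gt_rat1.
  by exists (l, inl 0%R); right.
- by move=> [l v]; have [v' h] := filling_gt v; exists (l, v'); right.
Qed.

(** * Recovering the colours from the dense order *)

Definition not_countably_approached (T : Type) (r : T -> T -> Prop) (p : T) : Prop :=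
  forall u : nat -> T, (forall n, r p (u n)) -> exists2 q, r p q & forall n, r q (u n).

(** Countably many points above the marker meet boundedly many of the copies of the rationals in its
    filling, so a further copy lies below them. Any other point is approached by the rationals above
    it in its copy. *)
Lemma marker_spec w l v :
  not_countably_approached (filled_lt w) (l, v) <-> v = marker.
Proof.
have slo := slo_filled w; split=> [h|-> u hu]; last first.
  have [k hk] := nat_bounded (fun n => if (u n).2 is inr (inr kq) then kq.1 else o).
  exists (l, inr (inr (k, 0%R))); first by right.
  move=> n; have := hk n; have := hu n; case: (u n) => l' v' [/= lt|[/= <-]]; first by left.
  by case: v' => [q|[[]|[k' q]]] //= _ lt; right; split=> //=; left.
have approached (emb : rat -> filling) (q : rat) : v = emb q ->
    (forall r s, filling_lt (emb r) (emb s) <-> r < s) ->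
    (forall v' r, filling_lt (emb q) v' -> filling_lt v' (emb r) ->
       exists s, v' = emb s) -> False.
  move=> vE emono econv.
  (* u lists all rationals above q, with q + 1 wherever the enumeration gives none. *)
  pose u n := if unpickle n is Some r then if q < r then r else (q + 1)%R else (q + 1)%R.
  have qu n : q < u n.
    by rewrite /u; case: unpickle => [r|]; [case: ifP => //|]; rewrite lt_rat1.
  have [|[l' v'] /= h1 h2] := h (fun n => (l, emb (u n))).
    by move=> n; right; split=> //=; rewrite vE; apply/emono.
  have E : l = l'.
    case: h1 => /= [lt|[//]]; have := h2 0%N => -[/= lt'|[/= E' _]].
      by have := slo_asym (slo_stems w) lt lt'.
    by move: lt; rewrite E' => /(slo_irr (slo_stems w)).
  have inner (a b : filling) : filled_lt w (l, a) (l, b) -> filling_lt a b.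
    by case=> [/(slo_irr (slo_stems w))|[]].
  rewrite -E vE in h1 h2; move: h1 => /inner h1.
  have [s v's] := econv _ _ h1 (inner _ _ (h2 0%N)).
  rewrite v's in h1 h2; move: h1 => /emono qs.
  have := h2 (pickle s) => /inner /emono.
  by rewrite /u pickleK qs ltxx.
case: v h approached => [q|[[]//|[k q]]] h approached; exfalso.
  by apply: (approached (@inl _ _) q) => // -[s|v'] r //= _ _; exists s.
apply: (approached (fun q => inr (inr (k, q))) q) => //.
  by move=> r s; split=> [[/=|[]//]|rs]; [rewrite ltxx|right].
move=> [s|[[]|[k' s]]] r //= [/= lt|[/= <- _]]; last by exists s.
case=> [/= lt'|[/= E _]]; last by rewrite E ltxx in lt.
by have := lt_trans lt lt'; rewrite ltxx.
Qed.

Lemma filled_iso (wx wy : K -> K) :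
  coloured_iso (skeleton_lt o) [set: skeleton K] (skeleton_colour o W wx)
    [set: skeleton K] (skeleton_colour o W wy) ->
  exists2 F : filled -> filled, bijective F &
    forall p q, filled_lt wx p q <-> filled_lt wy (F p) (F q).
Proof.
move=> [f [_ fm fs fc]]; have slo := slo_skeleton o.
have finj a b : f a = f b -> a = b by exact: (mono_inj slo fm).
have fmE a b : skeleton_lt o a b <-> skeleton_lt o (f a) (f b).
  by split; [exact: fm|exact: (mono_reflect slo fm)].
pose F (p : filled) : filled := ((f p.1.1, p.1.2), p.2).
exists F.
  apply: inj_surj_bijective => [[[n b] v] [[n' b'] v'] [/finj -> -> ->] //|[[n b] v]].
  by have [a _ <-] := fs n I; exists ((a, b), v).
move=> [[n b] v] [[n' b'] v']; rewrite /filled_lt /stems_lt /lex_sum /= fc // -fmE.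
have -> : (f n = f n') = (n = n') by apply/propext; split=> [/finj|->].
suff -> : ((f n, b) = (f n', b')) = ((n, b) = (n', b')) by [].
by apply/propext; split=> -[]; [move=> /finj -> ->|move=> -> ->].
Qed.

(** By [marker_spec] the markers are definable from the order, hence preserved. *)
Lemma stems_iso (wx wy : K -> K) (F : filled -> filled) : bijective F ->
  (forall p q, filled_lt wx p q <-> filled_lt wy (F p) (F q)) ->
  exists G : stem -> stem, forall l, F (l, marker) = (G l, marker).
Proof.
move=> [F' FK F'K] FE; have /choice[G hG] l : exists l', F (l, marker) = (l', marker).
  have /marker_spec h : not_countably_approached (filled_lt wy) (F (l, marker)).
    move=> u hu; have [|q h1 h2] := (marker_spec wx l marker).2 erefl (F' \o u).
      by move=> n /=; apply/FE; rewrite F'K.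
    by exists (F q) => [|n]; [exact/FE|have /FE := h2 n; rewrite /= F'K].
  by move: h; case: (F _) => l' v' /= ->; exists l'.
by exists G.
Qed.

Definition tip (a b : K) : stem := ((a, [::]), b).

(** Among the stem elements of level at least a, those that start no descending sequence within
    these levels are the [tip a b] with [b < w a]. [G] and its inverse preserve these levels, so [G]
    maps the well-order of type [wx a] increasingly into that of type [wy a]. *)
Lemma stems_iso_colour_le (wx wy : K -> K) (G G' : stem -> stem) (a : K) :
  cancel G G' ->  cancel G' G ->
  (forall l l', stems_lt wx l l' -> stems_lt wy (G l) (G l')) ->
  (forall l l', stems_lt wy l l' -> stems_lt wx (G' l) (G' l')) ->
  is_limit a ->
  (forall b, b < a -> (G (tip b o)).1.1 < a) ->
  (forall b, b < a -> (G' (tip b o)).1.1 < a) -> wx a <= wy a.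
Proof.
move=> GK G'K Gm Gm' [_ lim] Ga Ga'.
have level_lt w l b : l.1.1 < b -> stems_lt w l (tip b o) by move=> lt; left; left.
have level_le w l l' : stems_lt w l l' -> l.1.1 <= l'.1.1.
  by case=> [[/ltW//|[-> _]//]|[-> _]].
(* As a is a limit, an element of level below a lies below some [tip b o] with b < a. *)
have stay H w w' : (forall l l', stems_lt w l l' -> stems_lt w' (H l) (H l')) ->
    (forall b, b < a -> (H (tip b o)).1.1 < a) ->
    forall l, l.1.1 < a -> (H l).1.1 < a.
  move=> Hm Ha l la; have [b lb ba] := lim _ la.
  apply: le_lt_trans (Ha _ ba); exact/level_le/Hm/level_lt.
have G_ge l : a <= l.1.1 -> a <= (G l).1.1.
  rewrite !leNgt; apply: contraNN => /(stay _ _ _ Gm' Ga'); by rewrite GK.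
have G'_ge l : a <= l.1.1 -> a <= (G' l).1.1.
  rewrite !leNgt; apply: contraNN => /(stay _ _ _ Gm Ga); by rewrite G'K.
pose descends w (l : stem) := exists u : nat -> stem,
  [/\ u 0%N = l, forall n, a <= (u n).1.1 & forall n, stems_lt w (u n.+1) (u n)].
have [nx hnx] : exists nx : K -> K, forall b, b < nx b.
  by have /choice[nx] := lt_succ; exists nx.
have tip_colour w b : stem_lt (skeleton_colour o W w (a, [::])) b = stem_lt (w a) b by [].
have desc_tip w b : w a <= b -> descends w (tip a b).
  move=> wb; have nxb n : w a <= iter n nx b.
    by elim: n => //= n IH; apply: le_trans IH _; exact/ltW.
  exists (fun n => tip a (iter n nx b)); split=> // n; right; split=> //.
  by rewrite tip_colour /stem_lt ltNge (nxb n.+1) (nxb n) /=.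
(* Such an element lies above the reversed part of the stem over [(a, [::])], where the sequence can
   continue. *)
have desc_other w n b : a <= n.1 -> n <> (a, [::]) -> descends w (n, b).
  move=> an ne; have [u [u0 ua um]] := desc_tip w (w a) (lexx _).
  exists (fun k => if k is k'.+1 then u k' else (n, b)); split=> // -[|k] //.
  rewrite u0; left; case: n an ne => c s /=; rewrite le_eqVlt => /orP[/eqP <-|ac] ne; last by left.
  by right; split=> //; case: s ne.
have ndesc w b : b < w a -> ~ descends w (tip a b).
  move=> bw [u [u0 ua um]].
  have un n : exists2 c, u n = tip a c & c < w a.
    elim: n => [|n [c uc cw]]; first by exists b.
    have := um n; have := ua n.+1; rewrite uc; case: (u n.+1) => -[c' s] b' /= ac'.
    case=> [[/= c'a|[_]]|[/= [-> ->]]].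
    - by move: c'a; rewrite ltNge ac'.
    - by case: s.
    - rewrite tip_colour /stem_lt; case: ltP => [b'w _|wb']; first by exists b'.
      by rewrite leNgt cw.
  apply: (no_descent wf (u := fun n => (u n).2)) => n.
  have [c uc cw] := un n; have [c' uc' c'w] := un n.+1.
  have := um n; rewrite uc uc' => -[/(slo_irr (slo_skeleton o))//|[_ /=]].
  by rewrite tip_colour /stem_lt c'w.
have G_tip b : b < wx a -> exists2 c, G (tip a b) = tip a c & c < wy a.
  move=> bw; have nd : ~ descends wy (G (tip a b)).
    move=> [u [u0 ua um]]; apply: (ndesc wx b bw); exists (G' \o u); split=> [|n|n] /=.
    - by rewrite u0 GK.
    - exact: G'_ge.
    - exact: Gm'.
  have := G_ge (tip a b) (lexx _); move: nd; case: (G (tip a b)) => n c nd /= an.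
  have [E|ne] := pselect (n = (a, [::])); last by case: nd; exact: desc_other.
  exists c; first by rewrite E.
  by rewrite ltNge; apply/negP => wc; apply: nd; rewrite E; exact: desc_tip.
have th_lt b c : b < c -> c < wx a -> (G (tip a b)).2 < (G (tip a c)).2.
  move=> bc cw; have bw := lt_trans bc cw.
  have : stems_lt wx (tip a b) (tip a c) by right; split=> //; rewrite tip_colour /stem_lt bw.
  move=> /Gm; have [b' -> b'w] := G_tip _ bw; have [c' -> c'w] := G_tip _ cw.
  case=> [/(slo_irr (slo_skeleton o))//|[_ /=]].
  by rewrite tip_colour /stem_lt b'w.
(* An increasing map between ordinals moves no element down. *)
have th_ge b : b < wx a -> b <= (G (tip a b)).2.
  elim/(wo_ind wf): b => b IH bw; rewrite leNgt; apply/negP => lt.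
  by have := IH _ lt (lt_trans lt bw); rewrite leNgt th_lt.
rewrite leNgt; apply/negP => lt; have := th_ge _ lt.
by have [c -> cw] := G_tip _ lt; rewrite leNgt cw.
Qed.

(** At a closed point a of [h], which is a limit, both [G] and its inverse keep the levels of the
    [tip b o] with b < a below a; so the colours are compared in both directions. *)
Lemma filled_iso_agree (wx wy : K -> K) (F : filled -> filled) : bijective F ->
  (forall p q, filled_lt wx p q <-> filled_lt wy (F p) (F q)) ->
  exists h : K -> K, (forall a, a < h a) /\
    forall a, closed_under h a -> wx a = wy a.
Proof.
move=> Fbij FE; have [G hG] := stems_iso Fbij FE.
have [F' FK F'K] := Fbij.
have FE' p q : filled_lt wy p q <-> filled_lt wx (F' p) (F' q).
  by rewrite FE !F'K.
have [G' hG'] := stems_iso (Bijective F'K FK) FE'.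
have GK : cancel G G' by move=> l; have := hG' (G l); rewrite -hG FK => -[].
have G'K : cancel G' G by move=> l; have := hG (G' l); rewrite -hG' F'K => -[].
have inner w l l' : filled_lt w (l, marker) (l', marker) <-> stems_lt w l l'.
  by split=> [[//|[]//]|]; left.
have Gm l l' : stems_lt wx l l' -> stems_lt wy (G l) (G l').
  by move=> /inner /FE; rewrite !hG => /inner.
have Gm' l l' : stems_lt wy l l' -> stems_lt wx (G' l) (G' l').
  by move=> /inner /FE'; rewrite !hG' => /inner.
have [nx hnx] : exists nx : K -> K, forall b, b < nx b.
  by have /choice[nx] := lt_succ; exists nx.
exists (fun b => Order.max (nx b) (Order.max (G (tip b o)).1.1 (G' (tip b o)).1.1)).
split=> [a|a [a_pos ha]]; first by rewrite lt_max hnx.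
have lim : is_limit a.
  split=> // b ba; exists (nx b) => //.
  by have := ha b ba; rewrite gt_max => /andP[].
have Ga b : b < a -> (G (tip b o)).1.1 < a by move=> /ha; rewrite !gt_max => /and3P[].
have Ga' b : b < a -> (G' (tip b o)).1.1 < a by move=> /ha; rewrite !gt_max => /and3P[].
apply/eqP; rewrite eq_le (stems_iso_colour_le GK G'K) //.
by rewrite (stems_iso_colour_le G'K GK).
Qed.

End Filling.

(** * Enumerating the filled order by kappa *)

Definition embeds (T K : Type) : Prop := exists f : T -> K, injective f.

Section Embeddings.
Variables (d : Order.disp_t) (K : orderType d).
Variable pi : seq K -> K.
Hypothesis pi_inj : injective pi.

Lemma embeds_inj (T U : Type) (f : T -> U) : injective f -> embeds U K -> embeds T K.
Proof. by move=> finj [g ginj]; exists (g \o f); exact: inj_comp. Qed.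

Lemma embeds_prod (T U : Type) : embeds T K -> embeds U K -> embeds (T * U) K.
Proof.
move=> [f finj] [g ginj]; exists (fun p => pi [:: f p.1; g p.2]).
by move=> [a b] [a' b'] /pi_inj [/finj -> /ginj ->].
Qed.

Lemma embeds_sum (T U : Type) : embeds T K -> embeds U K -> embeds (T + U) K.
Proof.
move=> [f finj] [g ginj].
exists (fun x => match x with inl t => pi [:: f t] | inr u => pi [:: g u; g u] end).
by move=> [a|b] [a'|b'] /pi_inj => [[/finj ->]|//|//|[/ginj ->]].
Qed.

Lemma embeds_seq (T : Type) : embeds T K -> embeds (seq T) K.
Proof.
move=> [f finj]; exists (fun s => pi (map f s)).
by move=> s t /pi_inj /(inj_map finj).
Qed.

Lemma embeds_countable (T : countType) : embeds T K.
Proof.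
exists (fun t => pi (nseq (pickle t) (pi [::]))) => t u /pi_inj /(congr1 size).
by rewrite !size_nseq => /(pcan_inj pickleK).
Qed.

Lemma embeds_filled : embeds (filled K) K.
Proof.
have embK : embeds K K by exists id.
apply: embeds_prod; last first.
  apply: embeds_sum; first exact: embeds_countable.
  apply: embeds_sum; first exact: embeds_countable.
  by apply: embeds_prod => //; exact: embeds_countable.
apply: embeds_prod => //; apply: embeds_prod => //; apply: embeds_seq.
apply: (@embeds_inj _ _ val); first exact: val_inj.
by apply: embeds_prod => //; exact: embeds_seq.
Qed.

Lemma filled_enum : exists f : K -> filled K, bijective f.
Proof.
have [g ginj] := embeds_filled.
apply: (@bernstein _ _ (fun a => (tip a a, marker K)) g) => //.
by move=> a b [].
Qed.

End Embeddings.

(** * Closed sets and their projections *)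

Definition agree d (K : orderType d) (a : K) (x y : K -> K) : Prop :=
  forall b, b < a -> x b = y b.

Lemma agree_sym d (K : orderType d) (a : K) x y : agree a x y -> agree a y x.
Proof. by move=> h b /h. Qed.

Lemma agree_trans d (K : orderType d) (a : K) x y z :
  agree a x y -> agree a y z -> agree a x z.
Proof. by move=> h h' b ba; rewrite h // h'. Qed.

Lemma agree_le d (K : orderType d) (a a' : K) x y :
  a <= a' -> agree a' x y -> agree a x y.
Proof. by move=> aa' h b ba; apply: h; exact: lt_le_trans ba aa'. Qed.

Definition closed2 d (K : orderType d) (D : (K -> K) -> (K -> K) -> Prop) : Prop :=
  forall x u, (forall a, exists x' u', [/\ agree a x x', agree a u u' & D x' u']) -> D x u.

Definition closed3 d (K : orderType d)
    (D : (K -> K) -> (K -> K) -> (K -> K) -> Prop) : Prop :=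
  forall x y z, (forall a, exists x' y' z',
    [/\ agree a x x', agree a y y', agree a z z' & D x' y' z']) -> D x y z.

Section Descriptive.
Variables (d : Order.disp_t) (K : orderType d).
Hypothesis hK : weakly_compact K.
Variable pi : seq K -> K.
Hypothesis pi_bij : bijective pi.
Variable o : K.
Hypothesis o_le : forall a : K, o <= a.

Let pi_inj : injective pi.
Proof. exact: bij_inj. Qed.

Let lt_succ (a : K) : exists b, a < b.
Proof. exact: (lt_succ_ex hK pi_inj). Qed.

Lemma decode_ex : exists dec : nat -> K -> K, forall s i, dec i (pi s) = nth o s i.
Proof. by case: pi_bij => g gK _; exists (fun i k => nth o (g k) i) => s i; rewrite gK. Qed.

Lemma closed_closed3 (C : set (kspace K * kspace K * kspace K)) :
  closed C -> closed3 (fun x y z => C (x, y, z)).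
Proof.
move=> hC x y z h; apply: hC => B [[P Q] [/= [[P1 P2] /= [nP1 nP2] sP] nQ] sB].
have base (t : kspace K) (A : set (kspace K)) : nbhs t A ->
    exists a, forall t', agree a t t' -> A t'.
  rewrite nbhsE => -[U [oU Ut] UA].
  have [a ha] := (open_kspaceP o U).1 oU t Ut.
  by exists a => t' tt'; apply/UA/ha => b /tt'.
have [a1 h1] := base _ _ nP1; have [a2 h2] := base _ _ nP2.
have [a3 h3] := base _ _ nQ.
have [x' [y' [z' [xx' yy' zz' Cxyz]]]] := h (Order.max a1 (Order.max a2 a3)).
exists (x', y', z'); split=> //; apply: sB; split=> /=; last first.
  by apply/h3/(agree_le _ zz'); rewrite !le_max lexx !orbT.
apply: sP; split=> /=; first by apply/h1/(agree_le _ xx'); rewrite !le_max lexx.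
by apply/h2/(agree_le _ yy'); rewrite !le_max lexx !orbT.
Qed.

(** A witness for a union stores the index in its value at o; a witness for an intersection
    interleaves kappa witnesses along [pi [:: i; b]]. *)
Lemma borel_projection (X : set (kspace K)) : kborel X ->
  exists2 D, closed2 D & forall x, X x <-> exists u, D x u.
Proof.
have [dec decE] := decode_ex.
elim=> {X} [p a|F _ IH|F _ IH].
- exists (fun x _ => basic_open p a x); last first.
    by move=> x; split=> [h|[]//]; exists x.
  move=> x u /(_ a)[x' [_ [xx' _ px']]] b ba.
  by rewrite xx' // px'.
- have /choice[D hD] i : exists D, closed2 D /\ forall x, F i x <-> exists u, D x u.
    by have [D h1 h2] := IH i; exists D.
  exists (fun x u => D (dec 0%N (u o)) x (fun b => dec 1%N (u b))).
    move=> x u h; apply: (hD _).1 => a; have [s os] := lt_succ o.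
    have [x' [u' [xx' uu' Dxu]]] := h (Order.max a s).
    exists x', (fun b => dec 1%N (u' b)); split.
    + by apply: agree_le xx'; rewrite le_max lexx.
    + by move=> b ba; rewrite uu' // lt_max ba.
    + by rewrite uu' // lt_max os orbT.
  move=> x; split=> [[i _ /(hD i).2[u Du]]|[u Du]].
    exists (fun b => pi [:: i; u b]); rewrite !decE /=.
    by rewrite (_ : (fun b => _) = u) //; apply/funext => b; rewrite decE.
  by exists (dec 0%N (u o)) => //; apply/(hD _).2; eexists; exact: Du.
- have /choice[D hD] i : exists D, closed2 D /\ forall x, F i x <-> exists u, D x u.
    by have [D h1 h2] := IH i; exists D.
  exists (fun x u => forall i, D i x (fun b => u (pi [:: i; b]))).
    move=> x u h i; apply: (hD _).1 => a.
    have [v hv] := regular hK pi_inj a (fun b => pi [:: i; b]).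
    have [x' [u' [xx' uu' Dxu]]] := h (Order.max a v).
    exists x', (fun b => u' (pi [:: i; b])); split=> //.
    + by apply: agree_le xx'; rewrite le_max lexx.
    + by move=> b ba; rewrite uu' // lt_max hv // orbT.
  move=> x; split=> [h|[u Du] i _]; last by apply/(hD i).2; eexists; exact: Du.
  have /choice[v hv] i : exists u, D i x u by apply/(hD i).2; exact: h.
  exists (fun k => v (dec 0%N k) (dec 1%N k)) => i.
  rewrite (_ : (fun b => _) = v i) //; by apply/funext => b; rewrite !decE.
Qed.

(** z codes a witness for C together with witnesses that x and y belong to X; the domain is thus
    absorbed into the closed set. *)
Lemma sigma11_closed3 (X : set (kspace K)) (E : set (kspace K * kspace K)) :
  kborel X -> Sigma11_rel X E ->
  exists2 D, closed3 D & forall x y, E (x, y) <-> exists z, D x y z.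
Proof.
move=> /borel_projection[D Dc DE] [C /closed_closed3 Cc ->].
have [dec decE] := decode_ex.
pose dc i (z : K -> K) b := dec i (z b).
have dc_agree i a z z' : agree a z z' -> agree a (dc i z) (dc i z').
  by move=> h b ba; rewrite /dc h.
exists (fun x y z => [/\ C (x, y, dc 0%N z), D x (dc 1%N z) & D y (dc 2%N z)]).
  move=> x y z h; split; [apply: Cc|apply: Dc|apply: Dc] => a;
    have [x' [y' [z' [xx' yy' zz' [h1 h2 h3]]]]] := h a.
  - by exists x', y', (dc 0%N z'); split=> //; exact: dc_agree.
  - by exists x', (dc 1%N z'); split=> //; exact: dc_agree.
  - by exists y', (dc 2%N z'); split=> //; exact: dc_agree.
move=> x y; split=> [[[[x' y'] z] [Cz [[/= Xx Xy] _]] [<- <-]]|[z [h1 h2 h3]]].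
  have [u Du] := (DE _).1 Xx; have [v Dv] := (DE _).1 Xy.
  pose w b := pi [:: z b; u b; v b].
  have d0 : dc 0%N w = z by apply/funext => b; rewrite /dc decE.
  have d1 : dc 1%N w = u by apply/funext => b; rewrite /dc decE.
  have d2 : dc 2%N w = v by apply/funext => b; rewrite /dc decE.
  by exists w; rewrite d0 d1 d2.
exists (x, y, dc 0%N z) => //; split=> //; split=> //; split=> /=.
  by apply/DE; exists (dc 1%N z).
by apply/DE; exists (dc 2%N z).
Qed.

Lemma kborel_setI (A B : set (kspace K)) : kborel A -> kborel B -> kborel (A `&` B).
Proof.
move=> hA hB; have [o' oo'] := lt_succ o.
have -> : A `&` B = \bigcap_i (if i == o then A else B).
  apply/seteqP; split=> [x [Ax Bx] i _|x h]; first by case: ifP.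
  by split; [have := h o I; rewrite eqxx|have := h o' I; rewrite gt_eqF].
by apply: kborel_bigcap => i; case: ifP.
Qed.

Lemma kborel_set0 : kborel (@set0 (kspace K)).
Proof.
have [o' oo'] := lt_succ o.
have -> : @set0 (kspace K) = basic_open (fun _ => o) o' `&` basic_open (fun _ => o') o'.
  apply/seteqP; split=> // x [/(_ o oo') h1 /(_ o oo')]; rewrite h1 => E.
  by rewrite E ltxx in oo'.
by apply: kborel_setI; exact: kborel_basic.
Qed.

(** As kappa^{<kappa} = kappa, V is the union of at most kappa basic open sets. *)
Lemma kborel_open (V : set (kspace K)) :
  (forall x, V x -> exists a, forall x', agree a x x' -> V x') -> kborel V.
Proof.
move=> hV; have [dec decE] := decode_ex.
have [W hW] := bounded_funs_enum hK pi_inj.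
pose B k : set (kspace K) := basic_open (W (dec 0%N k)) (dec 1%N k).
have -> : V = \bigcup_k (if `[< B k `<=` V >] then B k else set0).
  apply/seteqP; split=> [x Vx|x [k _]]; last by case: asboolP => // h /h.
  have [a ha] := hV x Vx; have [j hj] := hW x a.
  have BE : B (pi [:: j; a]) = [set x' | agree a x x'].
    rewrite /B !decE /=; apply/seteqP; split=> x' h b ba; first by rewrite h // hj.
    by rewrite -h // hj.
  by exists (pi [:: j; a]) => //; rewrite BE asboolT.
by apply: kborel_bigcup => k; case: ifP => _; [exact: kborel_basic|exact: kborel_set0].
Qed.

Lemma kborel_kcantor : kborel (@kcantor d K).
Proof.
have -> : @kcantor d K = \bigcap_a [set eta : kspace K | is_ord 0 (eta a) \/ is_ord 1 (eta a)].
  by apply/seteqP; split=> eta h a; [move=> _|]; apply: h.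
apply: kborel_bigcap => a; apply: kborel_open => eta h.
have [a' aa'] := lt_succ a; exists a' => eta' ee' /=.
by rewrite -ee'.
Qed.

(** Such an f is continuous: by regularity the [r k] with k < a have a common bound. *)
Lemma kborel_fun_local (X Y : set (kspace K)) (f : kspace K -> kspace K) (r : K -> K) :
  kborel X -> (forall x, X x -> Y (f x)) ->
  (forall x x' k, agree (r k) x x' -> f x k = f x' k) -> kborel_fun X Y f.
Proof.
move=> bX fY loc; split; first exact: fY.
move=> U /(open_kspaceP o) oU; apply: kborel_setI => //; apply: kborel_open => x /= Ux.
have [a ha] := oU _ Ux; have [v hv] := regular hK pi_inj a r.
exists v => x' xx'; apply: ha => b ba; apply/esym/loc.
by apply: agree_le xx'; exact/ltW/hv.
Qed.

Lemma is_ord0 (a : K) : is_ord 0 a <-> a = o.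
Proof.
rewrite /is_ord II0 card_eq0; split=> [/eqP E|->].
  apply/eqP; rewrite eq_le o_le andbT leNgt; apply/negP => oa.
  by have : below a o by []; rewrite E.
by apply/eqP/seteqP; split=> // b; rewrite /below /= ltNge o_le.
Qed.

Lemma is_ord1_o : ~ is_ord 1 o.
Proof.
rewrite /is_ord (_ : below o = set0); last first.
  by apply/seteqP; split=> // b; rewrite /below /= ltNge o_le.
rewrite card_eq_sym card_eq0 => /eqP E.
by have : (`I_1 : set nat) 0%N by []; rewrite E.
Qed.

Lemma is_ord1_ex : exists a : K, is_ord 1 a.
Proof.
have [a oa amin] := wo_min (cardinal_wf (wc_cardinal hK)) (lt_succ o).
exists a; rewrite /is_ord (_ : below a = [set o]); first exact: card_set1.
apply/seteqP; split=> [b ba|_ ->] //=.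
apply/eqP; rewrite eq_le o_le andbT leNgt; apply/negP => ob.
by have := amin _ ob; rewrite leNgt ba.
Qed.

Lemma iso_DLO_equivalence : borel_equivalence_space (@kcantor d K) (iso_DLO pi).
Proof.
split.
- exact: kborel_kcantor.
- by move=> [x y] [].
- move=> x Cx; split=> //=; have [Mx|nMx] := pselect (Mod_DLO pi x); last by right.
  by left; split=> //; split=> //; exists id => //; exists id.
- move=> x y [[/= Cx Cy] [[Mx [My [f fb fE]]]|[nMx nMy]]]; split=> //=; last by right.
  left; split=> //; split=> //; case: (fb) => g fK gK; exists g; first by exists f.
  by move=> a b; rewrite fE !gK.
- move=> x y z [[/= Cx Cy] h1] [[/= _ Cz] h2]; split=> //=.
  case: h1 h2 => [[Mx [My [f fb fE]]]|[nMx nMy]] [[My' [Mz [g gb gE]]]|[nMy' nMz]] //.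
    left; split=> //; split=> //; exists (g \o f); first exact: bij_comp.
    by move=> a b; rewrite fE gE.
  by right.
Qed.

(** * Approximations and the codes of their classes *)

Section Codes.
Variable D : (K -> K) -> (K -> K) -> (K -> K) -> Prop.
Hypothesis D_closed : closed3 D.
Variable W : K -> K -> K.
Hypothesis W_enum : forall (g : K -> K) (a : K), exists j, forall b, b < a -> W j b = g b.

(** A branch of length a through the tree of [D]. Its values lie below a so that they become
    regressive functions in [reaches_reflect]. *)
Definition approximates (a : K) (x y z : K -> K) : Prop :=
  (forall b, b < a -> [/\ x b < a, y b < a & z b < a]) /\
  forall b, b < a -> exists x' y' z',
    [/\ agree b x x', agree b y y', agree b z z' & D x' y' z'].

Inductive reaches (a : K) : (K -> K) -> (K -> K) -> Prop :=
| reaches_agree x y : agree a x y -> reaches a x y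
| reaches_step x x' y z : approximates a x x' z -> reaches a x' y -> reaches a x y.

Lemma approximates_agree a x1 x2 y z :
  agree a x1 x2 -> approximates a x1 y z -> approximates a x2 y z.
Proof.
move=> xx [h1 h2]; split=> b ba; first by rewrite -xx //; exact: h1.
have [x' [y' [z' [hx hy hz hD]]]] := h2 b ba; exists x', y', z'; split=> //.
apply: (agree_trans _ hx); apply: (agree_le (ltW ba)); exact: agree_sym.
Qed.

Lemma reaches_trans a x y z : reaches a x y -> reaches a y z -> reaches a x z.
Proof.
elim=> {x y} [x y xy|x x' y w xx' _ IH yz]; last exact: reaches_step xx' (IH yz).
move=> yz; case: yz xy => {y z} [y z yz|y y' z w yy' y'z] xy.
  by apply: reaches_agree; exact: agree_trans xy yz.
by apply: reaches_step y'z; apply: approximates_agree yy'; exact: agree_sym.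
Qed.

Definition interreachable (a : K) (x y : K -> K) : Prop :=
  reaches a x y /\ reaches a y x.

(* The value at non-limit points is the same for all x. *)
Definition class_code (x : K -> K) (a : K) : K :=
  if `[< is_limit a >] then xget o [set j | interreachable a (W j) x] else o.

Lemma interreachable_sym a x y : interreachable a x y -> interreachable a y x.
Proof. by case. Qed.

Lemma interreachable_trans a x y z :
  interreachable a x y -> interreachable a y z -> interreachable a x z.
Proof.
by move=> [xy yx] [yz zy]; split; [exact: reaches_trans xy yz|exact: reaches_trans zy yx].
Qed.

Lemma class_code_eq a x y : interreachable a x y -> class_code x a = class_code y a.
Proof.
move=> xy; rewrite /class_code; case: asboolP => // _; congr xget.
apply/seteqP; split=> j /= h; apply: interreachable_trans h _ => //.
exact: interreachable_sym.
Qed.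

Lemma agree_interreachable a x y : agree a x y -> interreachable a x y.
Proof. by move=> h; split; apply: reaches_agree => //; exact: agree_sym. Qed.

Lemma class_code_inv a x y : is_limit a ->
  class_code x a = class_code y a -> interreachable a x y.
Proof.
(* Some [W j] agrees with z below a, so the default of [xget] does not occur. *)
have code_spec z : interreachable a (W (xget o [set j | interreachable a (W j) z])) z.
  have [j hj] := W_enum z a.
  case: xgetP => [i _ //|/(_ j) []] /=; exact: agree_interreachable.
move=> lim; rewrite /class_code asboolT // => E.
apply: interreachable_trans (code_spec y); rewrite -E; exact: interreachable_sym.
Qed.

(** At closed points of the maximum of x, y, z and z', one step leads from x to y and one back. *)
Lemma class_code_related x y z z' : D x y z -> D y x z' ->
  exists h, forall a, closed_under h a -> class_code x a = class_code y a.
Proof.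
move=> Dz Dz'.
exists (fun b => Order.max (Order.max (x b) (y b)) (Order.max (z b) (z' b))).
move=> a [_ ha]; apply: class_code_eq.
have bound b : b < a -> [/\ x b < a, y b < a, z b < a & z' b < a].
  by move=> /ha; rewrite !gt_max => /andP[/andP[? ?] /andP[? ?]].
split; [apply: (@reaches_step _ _ y _ z)|apply: (@reaches_step _ _ x _ z')];
  try exact: reaches_agree; split=> b ba; have [h1 h2 h3 h4] := bound b ba; try by split.
  by exists x, y, z.
by exists y, x, z'.
Qed.

Lemma reaches_chain a x y : reaches a x y ->
  exists n (X Z : nat -> K -> K), [/\ X 0%N = x, agree a (X n) y &
    forall m, (m < n)%N -> approximates a (X m) (X m.+1) (Z m)].
Proof.
elim=> {x y} [x y xy|x x' y z xx' _ [n [X [Z [X0 Xn XZ]]]]].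
  by exists 0%N, (fun _ => x), (fun _ => x).
exists n.+1, (fun m => if m is m'.+1 then X m' else x), (fun m => if m is m'.+1 then Z m' else z).
by split=> // -[|m] /=; [rewrite X0|exact: XZ].
Qed.

(** By [reflection] the length and all values of the chains for closed a become constant along a
    sequence [A] of such a tending to kappa. The limits form a chain in [D] because [D] is
    closed. *)
Lemma reaches_reflect (h x y : K -> K) : (forall a, a < h a) ->
  (forall a, closed_under h a -> reaches a x y) ->
  exists n (X : nat -> K -> K), [/\ X 0%N = x, X n = y &
    forall m, (m < n)%N -> exists z, D (X m) (X m.+1) z].
Proof.
move=> h_gt hxy.
have /choice[t ht] a : exists t : nat * ((nat -> K -> K) * (nat -> K -> K)),
    closed_under h a -> [/\ t.2.1 0%N = x, agree a (t.2.1 t.1) y &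
    forall m, (m < t.1)%N -> approximates a (t.2.1 m) (t.2.1 m.+1) (t.2.2 m)].
  have [/hxy/reaches_chain[n [X [Z hn]]]|nc] := pselect (closed_under h a).
    by exists (n, (X, Z)).
  by exists (0%N, (fun _ => id, fun _ => id)).
(* [nu] codes the length of a chain by an element below every closed point, which makes the length
   regressive. *)
pose nu n := iter n h o.
have nu_mono : {homo nu : m n / (m < n)%N >-> m < n}.
  by apply: homo_ltn => [a b c|n]; [exact: lt_trans|exact: h_gt].
have nu_inj : injective nu.
  move=> m n E; case: (ltngtP m n) => // /nu_mono; by rewrite E ltxx.
pose J : Type := nat * K + (nat * K + unit).
have [code code_inj] : embeds J K.
  have e1 : embeds (nat * K) K.
    by apply: (embeds_prod pi_inj); [exact: (embeds_countable pi_inj)|exists id].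
  by apply: (embeds_sum pi_inj e1); apply: (embeds_sum pi_inj e1); exact: (embeds_countable pi_inj).
pose raw a (j : J) := match j with
  | inl (m, b) => (t a).2.1 m b
  | inr (inl (m, b)) => (t a).2.2 m b
  | inr (inr _) => nu (t a).1
  end.
(* [raw] is cut off to become regressive; the values that matter are below a. *)
pose g a j := if raw a j < a then raw a j else o.
have gE a j : raw a j < a -> g a j = raw a j by rewrite /g => ->.
have g_reg a j : closed_under h a -> o < a -> g a j < a by rewrite /g; case: ifP.
have nu_lt a n : closed_under h a -> nu n < a.
  move=> [[b ba] ha]; elim: n => [|n IH]; first exact: le_lt_trans (o_le _) ba.
  exact: ha.
have [A [A_closed A_unb A_st]] := reflection hK pi_inj (r := fun _ => o) code_inj g_reg.
have {A_st}/choice[G hG] := A_st.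
have [z0 [z0c z0n]] := eventually_ex hK pi_inj (eventually_and A_closed (hG (inr (inr tt)))).
pose n := (t (A z0)).1.
have ev_n : eventually_in (fun z => closed_under h (A z) /\ (t (A z)).1 = n).
  apply: eventually_imp (eventually_and A_closed (hG (inr (inr tt)))) => z [zc].
  by rewrite -z0n !gE /=; [split=> //; exact: nu_inj|exact: nu_lt|exact: nu_lt].
exists n, (fun m b => G (inl (m, b))); split.
- apply/funext => b.
  have [z [[zc zb] E]] := eventually_ex hK pi_inj
    (eventually_and (eventually_and A_closed (A_unb (x b))) (hG (inl (0%N, b)))).
  have [X0 _ _] := ht _ zc.
  by rewrite -E gE /= X0.
- apply/funext => b.
  have [z [[[zc zn] E] [zb zy]]] := eventually_ex hK pi_inj
    (eventually_and (eventually_and ev_n (hG (inl (n, b))))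
      (eventually_and (A_unb b) (A_unb (y b)))).
  have [_ Xn _] := ht _ zc; have {}Xn := Xn b zb; rewrite zn in Xn.
  by rewrite -E gE /= Xn.
(* Late enough along [A], the limits coincide below a with the chain at [A z], whose restrictions to
   a extend to a triple in [D]. *)
- move=> m mn; exists (fun b => G (inr (inl (m, b)))); apply: D_closed => a.
  have ev_a (j : K -> J) : eventually_in (fun z => forall b, b < a -> g (A z) (j b) = G (j b)).
    by apply: (eventually_below hK pi_inj) => b _; exact: hG.
  have [z [[[zc zn] za] [h1 [h2 h3]]]] := eventually_ex hK pi_inj
    (eventually_and (eventually_and ev_n (A_unb a))
      (eventually_and (ev_a (fun b => inl (m, b)))
        (eventually_and (ev_a (fun b => inl (m.+1, b))) (ev_a (fun b => inr (inl (m, b))))))).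
  have [_ _ /(_ m)] := ht _ zc; rewrite zn => /(_ mn) [bd appr].
  have [x' [y' [z' [xx' yy' zz' Dxyz]]]] := appr a za.
  have lim b : b < a -> b < A z by move=> ba; exact: lt_trans ba za.
  exists x', y', z'; split=> //.
  + move=> b ba; have [? ? ?] := bd b (lim b ba).
    by rewrite -h1 // gE //= xx'.
  + move=> b ba; have [? ? ?] := bd b (lim b ba).
    by rewrite -h2 // gE //= yy'.
  + move=> b ba; have [? ? ?] := bd b (lim b ba).
    by rewrite -h3 // gE //= zz'.
Qed.

End Codes.
End Descriptive.

(** * The reduction *)

Section Completeness.
Variables (d : Order.disp_t) (K : orderType d).
Hypothesis hK : weakly_compact K.
Variable pi : seq K -> K.
Hypothesis pi_bij : bijective pi.

(** [w] enters the comparison only through the colour of the first point. This makes the reduction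
    local in x. *)
Lemma filled_lt_eq (o : K) (W : K -> K -> K) (w w' : K -> K) (p q : filled K) :
  w p.1.1.1 = w' p.1.1.1 -> filled_lt o W w p q <-> filled_lt o W w' p q.
Proof.
move=> E; rewrite /filled_lt /stems_lt /lex_sum.
have -> // : skeleton_colour o W w p.1.1 = skeleton_colour o W w' p.1.1.
by rewrite /skeleton_colour E.
Qed.

Lemma iso_DLO_complete (X : set (kspace K)) (E : set (kspace K * kspace K)) :
  borel_equivalence_space X E -> Sigma11_rel X E ->
  borel_reducible X E (@kcantor d K) (iso_DLO pi).
Proof.
move=> [bX EX Erefl Esym Etrans] SE.
have pi_inj := bij_inj pi_bij; have wf := cardinal_wf (wc_cardinal hK).
have lt_succ := lt_succ_ex hK pi_inj.
have [o _ o_le'] := wo_min wf (ex_intro (fun _ => True) (pi [::]) I).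
have o_le a : o <= a by exact: o_le'.
have [one one1] := is_ord1_ex hK pi_bij o_le.
have o_ord a := is_ord0 o_le a; have o1 := is_ord1_o o_le.
have [W hW] := bounded_funs_enum hK pi_inj.
have [phi phi_bij] := filled_enum pi_inj; have [psi phiK psiK] := phi_bij.
have [dec decE] := decode_ex pi_bij o.
have [D Dc DE] := sigma11_closed3 hK pi_bij o bX SE.
pose w x := class_code o D W x.
pose L x := filled_lt o W (w x).
pose f (x : kspace K) : kspace K := fun k =>
  if `[< exists a b, k = pi [:: o; a; b] /\ L x (phi a) (phi b) >] then one else o.
have f_ord x k : is_ord 0 (f x k) \/ is_ord 1 (f x k).
  by rewrite /f; case: ifP => _; [right|left; apply/o_ord].
have f_lt x a b : coded_lt pi (f x) a b <-> L x (phi a) (phi b).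
  split=> [[j /o_ord -> ]|h].
    rewrite /f; case: asboolP => // -[a' [b' [/pi_inj [-> ->] //]]].
  exists o; first exact/o_ord.
  by rewrite /f asboolT //; exists a, b.
have f_Mod x : Mod_DLO pi (f x).
  split; first exact: f_ord.
  have hL := filled_DLO o W (w x).
  split=> [a|a b c|a b|a b|a|a].
  - by move=> /f_lt; exact: (DLO_irr hL).
  - by rewrite !f_lt; exact: (DLO_trans hL).
  - rewrite !f_lt; have [?|[/(bij_inj phi_bij) ?|?]] := DLO_total hL (phi a) (phi b);
    by [left|right; left|right; right].
  - move=> /f_lt /(DLO_dense hL)[p [h1 h2]]; exists (psi p).
    by rewrite !f_lt psiK.
  - by have [p h] := DLO_nomin hL (phi a); exists (psi p); rewrite f_lt psiK.
  - by have [p h] := DLO_nomax hL (phi a); exists (psi p); rewrite f_lt psiK.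
exists f.
  (* The entry at [pi [:: o; a; b]] uses [w x] only at the level of [phi a], where the class code
     depends on x below that level. *)
  apply: (kborel_fun_local hK pi_bij o (r := fun k => (phi (dec 1%N k)).1.1.1)) => //.
    by move=> x _ a; exact: f_ord.
  move=> x x' k xx'; rewrite /f.
  suff -> : (exists a b, k = pi [:: o; a; b] /\ L x (phi a) (phi b)) =
      (exists a b, k = pi [:: o; a; b] /\ L x' (phi a) (phi b)) by [].
  have LE a b : k = pi [:: o; a; b] -> L x (phi a) (phi b) <-> L x' (phi a) (phi b).
    move=> kE; apply: filled_lt_eq; apply/class_code_eq/agree_interreachable.
    by move: xx'; rewrite kE decE.
  by apply/propext; split=> -[a [b [kE /(LE _ _ kE) h]]]; exists a, b.
move=> x y Xx Xy; split=> [Exy|[_ [[_ [_ [u u_bij uE]]]|[/(_ (f_Mod x))]//]]].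
  have [z Dz] := (DE x y).1 Exy; have [z' Dz'] := (DE y x).1 (Esym _ _ Exy).
  have [h hh] := class_code_related o W Dz Dz'.
  have iso : coloured_iso (skeleton_lt o) [set: skeleton K] (skeleton_colour o W (w x))
      [set: skeleton K] (skeleton_colour o W (w y)).
    apply: (coloured_iso_agree wf o_le hW lt_succ (h := h)) => //.
      exact: (closed_unbounded hK pi_inj h).
    by move=> a na; rewrite /w /class_code asboolF.
  have [F F_bij FE] := filled_iso iso.
  split; first by split=> a; exact: f_ord.
  left; split; first exact: f_Mod.
  split; first exact: f_Mod.
  exists (psi \o F \o phi).
    apply: bij_comp => //; apply: bij_comp => //.
    by exists phi.
  by move=> a b; rewrite !f_lt /= !psiK; exact: FE.
have [h [h_gt h_eq]] : exists h : K -> K, (forall a, a < h a) /\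
    forall a, closed_under h a -> w x a = w y a.
  apply: (filled_iso_agree (o := o) (W := W) wf lt_succ (nat_bounded hK pi_inj)
    (F := phi \o u \o psi)).
    apply: bij_comp; first exact: bij_comp.
    by exists phi.
  move=> p q; have := uE (psi p) (psi q); rewrite !f_lt !psiK; exact.
(* Closed points of [h] are limits since [h] exceeds the identity, so equal codes there yield chains
   of approximations. The chain in [D] obtained from them joins x to y, and E is transitive. *)
have [n [T [T0 Tn TD]]] : exists n (T : nat -> K -> K), [/\ T 0%N = x, T n = y &
    forall m, (m < n)%N -> exists z, D (T m) (T m.+1) z].
  apply: (reaches_reflect hK pi_bij o_le Dc h_gt) => a ha.
  have lim : is_limit a.
    by case: ha => a_pos ha; split=> // b ba; exists (h b); [exact: h_gt|exact: ha].
  by have [] := class_code_inv hW lim (h_eq a ha).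
rewrite -Tn; elim: (n) TD => [|m IH] TD; first by rewrite T0; exact: Erefl.
apply: Etrans (IH _) _; first by move=> k km; apply: TD; exact: ltnW.
by apply/DE/TD.
Qed.

End Completeness.

Theorem theorem5p9 (d : Order.disp_t) (K : orderType d)
    (hK : weakly_compact K) (pi : seq K -> K) (hpi : bijective pi) :
  Sigma11_complete_equivalence (@kcantor d K) (iso_DLO pi).
Proof.
split; first exact: (iso_DLO_equivalence hK hpi (pi [::])).
by move=> X E bE SE; exact: iso_DLO_complete.
Qed.
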